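(* Let $n \geq 2$ be an integer and let $a > 0$ be real. Let $$f_n(a) = \int_0^\infty \frac{(\ln x)^{n-1}\, dx}{(x-1)(x+a)}.$$ Then $$f_n(a) = \frac{(-1)^n (n-1)!}{1+a}\left[1 + (-1)^n\right]\zeta(n) + \frac{1}{n(1+a)} \sum_{j=0}^{\lfloor n/2 \rfloor} \binom{n}{2j}\,(2^{2j}-2)\,(-1)^{j-1} B_{2j}\, \pi^{2j}\, (\log a)^{n-2j}.$$
   Context: The integrand has a removable singularity at $x=1$ since $n \geq 2$. Both $\ln$ and $\log$ denote the natural logarithm. $\zeta(n) = \sum_{k\ge 1} k^{-n}$ is the Riemann zeta function. $B_k = B_k(0)$ are the Bernoulli numbers, where the Bernoulli polynomials $B_k(q)$ are defined by $\frac{t e^{qt}}{e^t-1} = \sum_{k=0}^\infty B_k(q)\frac{t^k}{k!}$. The term $(\log a)^0$ is read as $1$, including when $a=1$. *)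

(* Defs.v *)
From Stdlib Require Import Arith Factorial Reals Lra Lia.
From Coquelicot Require Import Coquelicot.
Open Scope R_scope.

(* At x = 1 Stdlib's total division gives the value 0 instead of the limit; the
   Riemann integral is insensitive to the value at one point. *)
Definition integrand (n : nat) (a x : R) : R :=
  (ln x) ^ (n - 1) / ((x - 1) * (x + a)).

Definition zeta (n : nat) : R := Series (fun k => / (INR (S k)) ^ n).

(* The power series identity is required on a punctured neighbourhood of t = 0
   (possibly depending on q), since the left-hand side t e^(qt) / (e^t - 1) has a
   removable singularity there; this determines all the numbers B k q.
   Existence is the lemma bernoulli_polynomials_exist below. *)
Definition bernoulli_polynomials (B : nat -> R -> R) : Prop :=
  forall q : R,
    locally' 0 (fun t : R =>
      is_pseries (fun k => B k q / INR (fact k)) t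
                 (t * exp (q * t) / (exp t - 1))).

Lemma cv_radius_ge1 (a : nat -> R) :
  (forall n, Rabs (a n) <= 1) -> Rbar_le 1 (CV_radius a).
Proof.
intros H.
apply (proj1 (CV_radius_bounded a)).
exists 1; intros n; rewrite pow1, Rmult_1_r; apply H.
Qed.

(* Coefficients of t / (e^t - 1); bern_upto n is correct up to index n. *)
Fixpoint bern_upto (n : nat) : nat -> R :=
  match n with
  | O => fun _ => 1
  | S m => fun k =>
      if Nat.leb k m then bern_upto m k
      else - sum_f_R0 (fun i => bern_upto m i / INR (fact (S (S m) - i))) m
  end.

Definition bern (n : nat) : R := bern_upto n n.

Lemma bern_uptoE n k : (k <= n)%nat -> bern_upto n k = bern k.
Proof.
induction n as [|n IH]; intros H.
- now replace k with 0%nat by lia.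
- destruct (Nat.eq_dec k (S n)) as [->|Hk]; [reflexivity|].
  simpl; rewrite (proj2 (Nat.leb_le k n)) by lia; apply IH; lia.
Qed.

Lemma bernS n :
  bern (S n) = - sum_f_R0 (fun i => bern i / INR (fact (S (S n) - i))) n.
Proof.
unfold bern at 1; cbn [bern_upto].
rewrite (proj2 (Nat.leb_gt (S n) n)) by lia.
f_equal; apply sum_eq; intros i Hi; now rewrite bern_uptoE.
Qed.

Lemma sum_inv_fact_le n :
  sum_f_R0 (fun i => / INR (fact (S (S n) - i))) n <= 1.
Proof.
rewrite (sum_eq _ (fun i => (fun j => / INR (fact (S (S j)))) (n - i)%nat)).
2: { intros i Hi; do 3 f_equal; lia. }
rewrite (sum_f_R0_skip (fun j => / INR (fact (S (S j))))).
assert (T := exp_ge_taylor 1 (S (S n)) ltac:(lra)).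
rewrite decomp_sum, decomp_sum in T by (simpl; lia).
cbn [Init.Nat.pred] in T.
rewrite (sum_eq _ (fun j => / INR (fact (S (S j))))) in T.
2: { intros i _; unfold Rdiv; rewrite pow1; ring. }
rewrite !pow1 in T.
replace (INR (fact 0)) with 1 in T by reflexivity.
replace (INR (fact 1)) with 1 in T by reflexivity.
assert (E := exp_le_3); lra.
Qed.

Lemma bern_le1 n : Rabs (bern n) <= 1.
Proof.
induction n as [[|n] IH] using (well_founded_induction lt_wf).
- unfold bern; simpl; rewrite Rabs_R1; lra.
- rewrite bernS, Rabs_Ropp.
  eapply Rle_trans; [apply Rsum_abs|].
  eapply Rle_trans; [|apply (sum_inv_fact_le n)].
  apply sum_Rle; intros i Hi.
  assert (P := Rinv_0_lt_compat _ (INR_fact_lt_0 (S (S n) - i))).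
  unfold Rdiv; rewrite Rabs_mult, (Rabs_pos_eq (/ _)) by lra.
  rewrite <- (Rmult_1_l (/ _)) at 2.
  apply Rmult_le_compat_r; [lra|]; apply IH; lia.
Qed.

Lemma bern_conv n :
  PS_mult bern (fun k => / INR (fact (S k))) n = if Nat.eqb n 0 then 1 else 0.
Proof.
unfold PS_mult; destruct n as [|n].
- unfold bern; simpl; field.
- rewrite tech5, Nat.sub_diag, bernS.
  replace (/ INR (fact 1)) with 1 by (simpl; field).
  rewrite (sum_eq _ (fun i => bern i / INR (fact (S (S n) - i)))).
  2: { intros i Hi; unfold Rdiv; do 4 f_equal; lia. }
  simpl; ring.
Qed.

Lemma is_pseries_bern t :
  0 < Rabs t < 1 -> is_pseries bern t (t / (exp t - 1)).
Proof.
intros [Ht0 Ht1].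
assert (Nt : t <> 0) by (intros ->; rewrite Rabs_R0 in Ht0; lra).
assert (Nz : exp t - 1 <> 0).
{ intros E; apply Nt, exp_inv; rewrite exp_0; lra. }
assert (Rb : Rbar_lt (Rabs t) (CV_radius bern)).
{ apply Rbar_lt_le_trans with 1; [exact Ht1|].
  apply cv_radius_ge1, bern_le1. }
assert (Re : Rbar_lt (Rabs t) (CV_radius (fun k => / INR (fact (S k))))).
{ apply Rbar_lt_le_trans with 1; [exact Ht1|].
  apply cv_radius_ge1; intros n.
  assert (P := INR_fact_lt_0 (S n)).
  rewrite Rabs_pos_eq by (left; now apply Rinv_0_lt_compat).
  rewrite <- Rinv_1; apply Rinv_le_contravar; [lra|].
  apply (le_INR 1), lt_O_fact. }
assert (He : is_pseries (fun k => / INR (fact (S k))) t (/ t * (exp t - 1))).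
{ assert (H0 := is_pseries_decr_1 (fun k => / INR (fact k)) t (/ t) (exp t)
                  (Rinv_l t Nt) (is_exp_Reals t)).
  replace (/ t * (exp t - 1))
    with (scal (/ t) (plus (exp t) (opp (/ INR (fact 0))))); [exact H0|].
  unfold scal, plus, opp; simpl; unfold mult; simpl; field; exact Nt. }
assert (Hb : is_pseries bern t (PSeries bern t)).
{ apply PSeries_correct, CV_radius_inside, Rb. }
assert (Hm := is_pseries_mult _ _ _ _ _ Hb He Rb Re).
assert (E1 : PSeries bern t * (/ t * (exp t - 1)) = 1).
{ rewrite <- (is_pseries_unique _ _ _ Hm), (PSeries_ext _ _ t bern_conv).
  rewrite PSeries_decr_1.
  - rewrite (PSeries_ext _ (fun _ => 0)) by reflexivity.
    rewrite PSeries_const_0; simpl; ring.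
  - eapply ex_pseries_ext; [exact bern_conv|]; eexists; exact Hm. }
replace (t / (exp t - 1)) with (PSeries bern t); [exact Hb|].
apply (Rmult_eq_reg_r (/ t * (exp t - 1))).
- rewrite E1; field; split; assumption.
- apply Rmult_integral_contrapositive_currified; [now apply Rinv_neq_0_compat|].
  exact Nz.
Qed.

Lemma is_pseries_exp_scal q t :
  is_pseries (fun n => q ^ n / INR (fact n)) t (exp (q * t)).
Proof.
apply is_series_ext with (2 := is_exp_Reals (q * t)); intros n.
unfold scal; simpl; unfold mult; simpl.
rewrite (pow_n_pow (q * t)), (pow_n_pow t), Rpow_mult_distr.
change (q ^ n * t ^ n * / INR (fact n) = t ^ n * (q ^ n / INR (fact n)) :> R).
unfold Rdiv; ring.
Qed.

Lemma bernoulli_polynomials_exist : exists B, bernoulli_polynomials B.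
Proof.
pose (c := fun q => PS_mult bern (fun n => q ^ n / INR (fact n))).
exists (fun k q => c q k * INR (fact k)); intros q.
exists (mkposreal 1 Rlt_0_1); intros t Ht Nt.
assert (Ht1 : Rabs t < 1).
{ revert Ht; unfold ball; simpl; unfold AbsRing_ball, minus, plus, opp, abs; simpl.
  now rewrite Ropp_0, Rplus_0_r. }
apply is_pseries_ext with (c q).
{ intros k; change (c q k = c q k * INR (fact k) / INR (fact k) :> R).
  field; apply INR_fact_neq_0. }
replace (t * exp (q * t) / (exp t - 1)) with (t / (exp t - 1) * exp (q * t))
  by (unfold Rdiv; ring).
apply is_pseries_mult.
- apply is_pseries_bern; split; [now apply Rabs_pos_lt|assumption].
- apply is_pseries_exp_scal.
- apply Rbar_lt_le_trans with 1; [exact Ht1|].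
  apply cv_radius_ge1, bern_le1.
- apply Rbar_lt_le_trans with 1; [exact Ht1|].
  apply Rbar_not_lt_le; intros H.
  rewrite <- (Rabs_pos_eq 1) in H by lra.
  apply (CV_disk_outside _ _ H).
  apply is_lim_seq_ext with (2 := ex_series_lim_0 _ (ex_intro _ _ (is_pseries_exp_scal q 1))).
  intros n; unfold scal; simpl; unfold mult; simpl; rewrite pow_n_pow; ring.
Qed.

(* Main.v *)
Require Import Defs.
From Stdlib Require Import ZArith Factorial Reals Lra Lia.
From Coquelicot Require Import Coquelicot.
Open Scope R_scope.

(** Put [x = exp u] and [L = ln a].  Since
    [(1 + a) / ((x - 1) (x + a)) = 1 / (x - 1) - 1 / (x + a)], the integral over
    [x > 1] and the integral over [x < 1] (after [u -> - u]) become, up to the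
    factor [1 / (1 + a)] and, for the second one, the sign [(-1) ^ n],
      - a Bose integral [int_0^oo u^(n-1) / (e^u - 1) du], which is
        [(n-1)! zeta n] by expanding in a geometric series
        ([halfline_pow_todd]): the two of them make the first term of the
        formula;
      - the Fermi-Dirac integral [int_0^oo u^(n-1) / (1 + e^(u-L)) du], with
        [L] replaced by [- L] in the second one ([halfline_fermi_dirac]).

    The two Fermi-Dirac integrals combine to a polynomial in [L]
    ([fermi_dirac_inversion]): after translating by [L], the pieces between
    [- L] and [0] add up to the integral of [(v + L)^(n-1)], because
    [1 / (1 + e^v) + 1 / (1 + e^(-v)) = 1], while on the half-line only the odd
    moments [int_0^oo v^(2j-1) / (1 + e^v) dv] survive.  These moments are
    [(1 - 2^(1-2j)) (2j-1)! zeta (2j)], by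
    [1 / (e^v + 1) = 1 / (e^v - 1) - 2 / (e^(2v) - 1)].

    It remains to know Euler's value of [zeta (2j)] in terms of the Bernoulli
    numbers ([bernoulli_even]).  It is read off from the partial fraction
    expansion [t coth t = 1 + 2 sum_m t^2 / (t^2 + m^2 pi^2)]
    ([is_series_coth]) by expanding each fraction in powers of [t] and by
    uniqueness of power series coefficients.  The partial fraction expansion
    is the value at [x = 0] of the cosine series of [cosh (t (1 - x))]; its
    convergence comes from the Dirichlet kernel and the Riemann-Lebesgue lemma
    ([dirichlet_localization]). *)

(** * Integrals over a half-line *)

(** The integral of [f] over [0, oo).  Continuity on the whole line is made part
    of the notion: every integrand below has it, and it makes all the integrals
    over segments exist, so that the calculus rules have no side conditions. *)
Definition is_halfline_RInt (f : R -> R) (l : R) : Prop :=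
  (forall x, continuous f x) /\ is_lim (fun b => RInt f 0 b) p_infty l.

Lemma ex_RInt_continuous_all (f : R -> R) (a b : R) :
  (forall x, continuous f x) -> ex_RInt f a b.
Proof. intros H; apply (ex_RInt_continuous (V := R_CompleteNormedModule)); auto. Qed.

Lemma continuous_of_ex_derive (f : R -> R) :
  (forall x, ex_derive f x) -> forall x, continuous f x.
Proof. intros H x; apply (ex_derive_continuous (K := R_AbsRing) (V := R_NormedModule)), H. Qed.

Lemma halfline_ext (f g : R -> R) (l : R) :
  (forall x, f x = g x) -> is_halfline_RInt f l -> is_halfline_RInt g l.
Proof.
intros E [Hc Hl]; split.
- intros x; apply continuous_ext with f; auto.
- apply is_lim_ext with (2 := Hl); intros b; apply RInt_ext; auto.
Qed.

Lemma halfline_plus (f g : R -> R) (lf lg : R) :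
  is_halfline_RInt f lf -> is_halfline_RInt g lg ->
  is_halfline_RInt (fun x => f x + g x) (lf + lg).
Proof.
intros [Hf Lf] [Hg Lg]; split.
- intros x; apply (continuous_plus (V := R_NormedModule)); auto.
- apply is_lim_ext with (fun b => RInt f 0 b + RInt g 0 b).
  + intros b; symmetry; apply (RInt_plus (V := R_CompleteNormedModule));
      now apply ex_RInt_continuous_all.
  + now apply is_lim_plus'.
Qed.

Lemma halfline_scal (c : R) (f : R -> R) (l : R) :
  is_halfline_RInt f l -> is_halfline_RInt (fun x => c * f x) (c * l).
Proof.
intros [Hf Lf]; split.
- intros x; apply (continuous_scal_r (V := R_NormedModule)); auto.
- apply is_lim_ext with (fun b => c * RInt f 0 b).
  + intros b; symmetry; apply (RInt_scal (V := R_CompleteNormedModule));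
      now apply ex_RInt_continuous_all.
  + apply (is_lim_scal_l _ c p_infty l Lf).
Qed.

Lemma halfline_sum (f : nat -> R -> R) (l : nat -> R) (N : nat) :
  (forall k, (k <= N)%nat -> is_halfline_RInt (f k) (l k)) ->
  is_halfline_RInt (fun x => sum_f_R0 (fun k => f k x) N) (sum_f_R0 l N).
Proof.
induction N as [|N IH]; intros H; simpl.
- apply halfline_ext with (2 := H 0%nat (le_n 0)); reflexivity.
- apply halfline_plus; auto.
Qed.

Lemma is_lim_affine_p_infty (u v : R) :
  0 < u -> is_lim (fun x => u * x + v) p_infty p_infty.
Proof.
intros Hu P [M HM]; exists ((M - v) / u); intros x Hx; apply HM.
apply Rmult_lt_compat_l with (r := u) in Hx; [|exact Hu].
replace (u * ((M - v) / u)) with (M - v) in Hx by (field; lra); lra.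
Qed.

Lemma is_lim_p_infty_comp (f g : R -> R) (l : R) :
  is_lim f p_infty l -> is_lim g p_infty p_infty ->
  is_lim (fun x => f (g x)) p_infty l.
Proof.
intros Hf Hg; apply is_lim_comp with p_infty; auto.
exists 0; discriminate.
Qed.

(** The substitution [u x + v], which moves the lower end [0] to [v]: the
    resulting defect is the proper integral from [v] to [0]. *)
Lemma halfline_affine (u v : R) (f : R -> R) (l : R) :
  0 < u -> is_halfline_RInt f l ->
  is_halfline_RInt (fun x => f (u * x + v)) (/ u * (RInt f v 0 + l)).
Proof.
intros Hu [Hf Lf]; split.
- intros x; apply (continuous_comp (fun x => u * x + v) f); [|apply Hf].
  apply continuous_of_ex_derive; intros y; auto_derive; auto.
- apply is_lim_ext with (fun b => / u * (RInt f v 0 + RInt f 0 (u * b + v))).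
  + intros b.
    assert (E := RInt_comp_lin (V := R_CompleteNormedModule) f u v 0 b
                   (ex_RInt_continuous_all _ _ _ Hf)).
    assert (C := RInt_Chasles (V := R_CompleteNormedModule) f v 0 (u * b + v)
      (ex_RInt_continuous_all _ _ _ Hf) (ex_RInt_continuous_all _ _ _ Hf)).
    change (RInt f v 0 + RInt f 0 (u * b + v) = RInt f v (u * b + v)) in C.
    rewrite C; rewrite Rmult_0_r, Rplus_0_l in E; rewrite <- E.
    rewrite (RInt_scal (V := R_CompleteNormedModule)).
    * unfold scal; simpl; unfold mult; simpl; field; lra.
    * apply ex_RInt_continuous_all; intros x.
      apply (continuous_comp (fun x => u * x + v) f); [|apply Hf].
      apply continuous_of_ex_derive; intros y; auto_derive; auto.
  + apply (is_lim_scal_l _ (/ u) p_infty (RInt f v 0 + l)).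
    apply is_lim_plus'; [apply is_lim_const|].
    apply (is_lim_p_infty_comp (fun b => RInt f 0 b)); auto.
    now apply is_lim_affine_p_infty.
Qed.

Lemma RInt_sum (f : nat -> R -> R) (a b : R) (N : nat) :
  (forall k, ex_RInt (f k) a b) ->
  is_RInt (fun x => sum_f_R0 (fun k => f k x) N) a b
    (sum_f_R0 (fun k => RInt (f k) a b) N).
Proof.
intros H; induction N as [|N IH]; simpl.
- apply (RInt_correct (V := R_CompleteNormedModule)), H.
- apply (is_RInt_plus (V := R_NormedModule)); [exact IH|].
  apply (RInt_correct (V := R_CompleteNormedModule)), H.
Qed.

Lemma RInt_reflect (f : R -> R) (a b : R) :
  (forall x, continuous f x) -> RInt (fun v => f (- v)) a b = RInt f (- b) (- a).
Proof.
intros Hf; apply (is_RInt_unique (V := R_CompleteNormedModule)).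
rewrite <- (opp_opp (G := R_AbelianGroup) (RInt f (- b) (- a))).
apply is_RInt_ext with (fun v => opp (opp (f (- v)))).
{ intros v _; apply (opp_opp (G := R_AbelianGroup)). }
apply (is_RInt_opp (V := R_NormedModule)), (is_RInt_comp_opp (V := R_NormedModule)).
apply (is_RInt_swap (V := R_NormedModule)), (RInt_correct (V := R_CompleteNormedModule)).
now apply ex_RInt_continuous_all.
Qed.

(** * Gamma integrals and the function x / (exp x - 1) *)

(** The function [x / (e^x - 1)], extended continuously at its removable
    singularity.  All the integrands with a factor [1 / (e^x - 1)] are written
    with it, so that they are continuous at [0]. *)
Definition todd (x : R) : R :=
  if Req_EM_T x 0 then 1 else x / (exp x - 1).

Lemma exp_minus_1_neq_0 (x : R) : x <> 0 -> exp x - 1 <> 0.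
Proof. intros H E; apply H, exp_inv; rewrite exp_0; lra. Qed.

(** The form of the definition that needs no case distinction at [0]. *)
Lemma todd_mult (x : R) : todd x * (exp x - 1) = x.
Proof.
unfold todd; destruct (Req_EM_T x 0) as [->|H].
- rewrite exp_0; ring.
- field; now apply exp_minus_1_neq_0.
Qed.

Lemma todd_neq (x : R) : x <> 0 -> todd x = x / (exp x - 1).
Proof. unfold todd; now destruct (Req_EM_T x 0). Qed.

Lemma todd_0 : todd 0 = 1.
Proof. unfold todd; destruct (Req_EM_T 0 0); lra. Qed.

Lemma continuous_todd (x : R) : continuous todd x.
Proof.
destruct (Req_EM_T x 0) as [->|Hx].
- apply continuity_pt_filterlim, continuity_pt_filterlim'.
  rewrite todd_0.
  change (is_lim todd 0 1).
  apply is_lim_ext_loc with (fun y => / ((exp y - 1) / y)).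
  + exists (mkposreal 1 Rlt_0_1); intros y _ Hy.
    rewrite todd_neq by exact Hy.
    field; split; auto using exp_minus_1_neq_0.
  + replace (Finite 1) with (Rbar_inv 1) by (simpl; now rewrite Rinv_1).
    apply is_lim_inv; [apply is_lim_div_expm1_0|].
    intros E; injection E; lra.
- apply (continuous_ext_loc todd (fun y => y / (exp y - 1))).
  + assert (Px : 0 < Rabs x) by now apply Rabs_pos_lt.
    exists (mkposreal _ Px); intros y Hy.
    symmetry; apply todd_neq; intros ->.
    revert Hy; unfold ball; simpl; unfold AbsRing_ball, minus, plus, opp, abs; simpl.
    rewrite Rplus_0_l, Rabs_Ropp; lra.
  + apply (ex_derive_continuous (K := R_AbsRing) (V := R_NormedModule)).
    auto_derive; now apply exp_minus_1_neq_0.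
Qed.

Lemma todd_bounds (x : R) : 0 <= x -> 0 <= todd x <= 1.
Proof.
intros Hx; destruct (Req_EM_T x 0) as [->|H].
- rewrite todd_0; lra.
- rewrite todd_neq by exact H.
  assert (E := exp_ineq1 x H).
  split.
  + apply Rdiv_le_0_compat; lra.
  + apply Rle_div_l; lra.
Qed.

Lemma todd_opp (x : R) : todd (- x) = todd x + x.
Proof.
destruct (Req_EM_T x 0) as [->|H].
- rewrite Ropp_0, todd_0; ring.
- rewrite !todd_neq by lra; rewrite exp_Ropp.
  assert (N := exp_minus_1_neq_0 x H); assert (P := exp_pos x).
  field; repeat split; try lra.
Qed.

(** The primitive of [v^k e^(-m v)] given by repeated integration by parts; it
    vanishes at infinity, so that its value at [0] gives the Gamma integral
    [k! / m^(k+1)]. *)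
Fixpoint gamma_primitive (m : R) (k : nat) (v : R) : R :=
  match k with
  | O => - exp (- (m * v)) / m
  | S k' => - v ^ k * exp (- (m * v)) / m + INR k / m * gamma_primitive m k' v
  end.

Lemma is_derive_gamma_primitive (m : R) (k : nat) (v : R) :
  0 < m -> is_derive (gamma_primitive m k) v (v ^ k * exp (- (m * v))).
Proof.
intros Hm; induction k as [|k IH].
- simpl; auto_derive; [auto|]; field; lra.
- cbn [gamma_primitive].
  replace (v ^ S k * exp (- (m * v)))
    with ((- INR (S k) * v ^ k * exp (- (m * v)) / m + v ^ S k * exp (- (m * v)))
          + INR (S k) / m * (v ^ k * exp (- (m * v)))) by (field; lra).
  apply (is_derive_plus (V := R_NormedModule)).
  + auto_derive; [auto|].
    change (match k with 0%nat => 1 | S _ => INR k + 1 end) with (INR (S k)).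
    rewrite <- (tech_pow_Rmult v k); field; lra.
  + apply is_derive_scal; exact IH.
Qed.

Lemma gamma_primitive_0 (m : R) (k : nat) :
  0 < m -> gamma_primitive m k 0 = - (INR (fact k) / m ^ S k).
Proof.
intros Hm; induction k as [|k IH].
- simpl; rewrite Rmult_0_r, Ropp_0, exp_0; field; lra.
- cbn [gamma_primitive]; rewrite IH.
  change (fact (S k)) with (S k * fact k)%nat; rewrite mult_INR, pow_i by lia.
  rewrite <- (tech_pow_Rmult m (S k)).
  field; split; try lra; apply pow_nonzero; lra.
Qed.

Lemma gamma_primitive_nonpos (m : R) (k : nat) (v : R) :
  0 < m -> 0 <= v -> gamma_primitive m k v <= 0.
Proof.
intros Hm Hv; assert (P := exp_pos (- (m * v))).
assert (I := Rinv_0_lt_compat _ Hm).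
induction k as [|k IH]; cbn [gamma_primitive].
- assert (0 <= exp (- (m * v)) / m) by (apply Rdiv_le_0_compat; lra).
  unfold Rdiv in *; lra.
- assert (Q := pow_le v (S k) Hv); assert (N := pos_INR (S k)).
  assert (0 <= v ^ S k * exp (- (m * v)) / m)
    by (apply Rdiv_le_0_compat; [apply Rmult_le_pos; lra|lra]).
  assert (0 <= INR (S k) / m * - gamma_primitive m k v)
    by (apply Rmult_le_pos; [apply Rdiv_le_0_compat; lra|lra]).
  unfold Rdiv in *; lra.
Qed.

(** The exponential dominates the term of degree [k + 1] of its Taylor series. *)
Lemma is_lim_pow_exp (m : R) (k : nat) :
  0 < m -> is_lim (fun v => v ^ k * exp (- (m * v))) p_infty 0.
Proof.
intros Hm.
pose (c := INR (fact (S k)) / m ^ S k).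
assert (Mk : 0 < m ^ S k) by (apply pow_lt; lra).
apply is_lim_le_le_loc with (fun _ => 0) (fun v => c * / v).
- exists 0; intros v Hv.
  assert (Vk := pow_lt v k Hv); assert (P := exp_pos (- (m * v))).
  split; [apply Rmult_le_pos; lra|].
  assert (T : (m * v) ^ S k / INR (fact (S k)) <= exp (m * v)).
  { eapply Rle_trans; [|apply (exp_ge_taylor (m * v) (S k))].
    - rewrite tech5.
      assert (0 <= sum_f_R0 (fun i => (m * v) ^ i / INR (fact i)) k); [|lra].
      apply cond_pos_sum; intros i; apply Rdiv_le_0_compat.
      + apply pow_le, Rmult_le_pos; lra.
      + apply INR_fact_lt_0.
    - apply Rmult_le_pos; lra. }
  rewrite exp_Ropp.
  assert (F := INR_fact_lt_0 (S k)).
  assert (E := exp_pos (m * v)).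
  unfold c.
  apply Rmult_le_reg_r with (exp (m * v)); [lra|].
  rewrite Rmult_assoc, Rinv_l, Rmult_1_r by lra.
  eapply Rle_trans; [|apply Rmult_le_compat_l; [|exact T]].
  + rewrite Rpow_mult_distr.
    apply Req_le; simpl (v ^ S k); field; repeat split; lra.
  + apply Rmult_le_pos; [apply Rdiv_le_0_compat; lra|].
    left; now apply Rinv_0_lt_compat.
- apply is_lim_const.
- replace (Finite 0) with (Rbar_mult c (Rbar_inv p_infty))
    by (simpl; f_equal; ring).
  apply is_lim_scal_l, is_lim_inv; [apply is_lim_id|discriminate].
Qed.

Lemma is_lim_gamma_primitive (m : R) (k : nat) :
  0 < m -> is_lim (gamma_primitive m k) p_infty 0.
Proof.
intros Hm; induction k as [|k IH].
- apply is_lim_ext with (fun v => (- / m) * (v ^ 0 * exp (- (m * v)))).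
  { intros v; simpl; field; lra. }
  replace (Finite 0) with (Rbar_mult (- / m) 0) by (simpl; f_equal; ring).
  apply is_lim_scal_l, is_lim_pow_exp, Hm.
- apply is_lim_ext with (fun v => (- / m) * (v ^ S k * exp (- (m * v)))
    + INR (S k) / m * gamma_primitive m k v).
  { intros v; cbn [gamma_primitive]; field; lra. }
  replace 0 with ((- / m) * 0 + INR (S k) / m * 0) by ring.
  apply is_lim_plus'.
  + apply (is_lim_scal_l _ (- / m) p_infty 0), is_lim_pow_exp, Hm.
  + apply (is_lim_scal_l _ (INR (S k) / m) p_infty 0), IH.
Qed.

Lemma RInt_pow_exp (m : R) (k : nat) (b : R) :
  0 < m ->
  RInt (fun v => v ^ k * exp (- (m * v))) 0 b =
  INR (fact k) / m ^ S k + gamma_primitive m k b.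
Proof.
intros Hm.
apply (is_RInt_unique (V := R_CompleteNormedModule)).
replace (INR (fact k) / m ^ S k + gamma_primitive m k b)
  with (minus (gamma_primitive m k b) (gamma_primitive m k 0)).
- apply (is_RInt_derive (V := R_CompleteNormedModule)).
  + intros x _; now apply is_derive_gamma_primitive.
  + intros x _; apply continuous_of_ex_derive; intros y; auto_derive; auto.
- unfold minus, plus, opp; simpl; rewrite gamma_primitive_0 by exact Hm.
  simpl; ring.
Qed.

Lemma halfline_pow_exp (m : R) (k : nat) :
  0 < m ->
  is_halfline_RInt (fun v => v ^ k * exp (- (m * v))) (INR (fact k) / m ^ S k).
Proof.
intros Hm; split.
- apply continuous_of_ex_derive; intros y; auto_derive; auto.
- apply is_lim_ext with
    (fun b => INR (fact k) / m ^ S k + gamma_primitive m k b).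
  { intros b; symmetry; now apply RInt_pow_exp. }
  replace (Finite (INR (fact k) / m ^ S k))
    with (Finite (INR (fact k) / m ^ S k + 0)) by (f_equal; ring).
  apply is_lim_plus'; [apply is_lim_const|now apply is_lim_gamma_primitive].
Qed.

Lemma RInt_pow_exp_le (m : R) (k : nat) (b : R) :
  0 < m -> 0 <= b ->
  RInt (fun v => v ^ k * exp (- (m * v))) 0 b <= INR (fact k) / m ^ S k.
Proof.
intros Hm Hb; rewrite RInt_pow_exp by exact Hm.
assert (H := gamma_primitive_nonpos m k b Hm Hb); lra.
Qed.

(** * The Bose integral and the Fermi moments *)

Lemma zeta_term_pos (n k : nat) : 0 < / INR (S k) ^ n.
Proof. apply Rinv_0_lt_compat, pow_lt, lt_0_INR; lia. Qed.

(** The partial sums of [1 / k^2] are bounded by a telescoping sum: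
    [1 / (k+1)^2 <= 1 / k - 1 / (k+1)]. *)
Lemma ex_series_zeta (n : nat) :
  (2 <= n)%nat -> ex_series (fun k => / INR (S k) ^ n).
Proof.
intros Hn.
assert (H : ex_finite_lim_seq (fun N => sum_f_R0 (fun k => / INR (S k) ^ n) N)).
{ apply ex_finite_lim_seq_incr with 2.
  - intros N; rewrite tech5; assert (P := zeta_term_pos n (S N)); lra.
  - intros N; apply Rle_trans with (2 - / INR (S N));
      [|assert (P := zeta_term_pos 1 N); rewrite pow_1 in P; lra].
    induction N as [|N IH].
    + simpl sum_f_R0; rewrite pow1; simpl; lra.
    + rewrite tech5.
      assert (Q : 1 <= INR (S N)) by (apply (le_INR 1); lia).
      rewrite (S_INR (S N)).
      assert (T : / (INR (S N) + 1) ^ n <= / (INR (S N) + 1) ^ 2).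
      { apply Rinv_le_contravar; [apply pow_lt; lra|].
        apply Rle_pow; [lra|lia]. }
      assert (U : / (INR (S N) + 1) ^ 2 <= / INR (S N) - / (INR (S N) + 1)).
      { replace (/ INR (S N) - / (INR (S N) + 1))
          with (/ (INR (S N) * (INR (S N) + 1))) by (field; lra).
        apply Rinv_le_contravar; nra. }
      lra. }
destruct H as [l Hl]; exists l.
apply is_lim_seq_ext with (2 := Hl); intros N; symmetry; apply sum_n_Reals.
Qed.

Lemma is_lim_seq_zeta (n : nat) :
  (2 <= n)%nat ->
  is_lim_seq (fun N => sum_f_R0 (fun k => / INR (S k) ^ n) N) (zeta n).
Proof.
intros Hn.
apply is_lim_seq_ext with (2 := Series_correct _ (ex_series_zeta n Hn)).
intros N; apply sum_n_Reals.
Qed.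

Lemma zeta_partial_le (n N : nat) :
  (2 <= n)%nat -> sum_f_R0 (fun k => / INR (S k) ^ n) N <= zeta n.
Proof.
intros Hn.
apply (is_lim_seq_incr_compare _ _ (is_lim_seq_zeta n Hn)).
intros M; rewrite tech5; assert (P := zeta_term_pos n (S M)); lra.
Qed.

(** [1 / (e^v - 1)] is the geometric series in [e^(-v)]; the remainder is kept
    exact because it is integrated below. *)
Lemma todd_geometric (N : nat) (v : R) :
  todd v = sum_f_R0 (fun k => v * exp (- (INR (S k) * v))) N
           + todd v * exp (- (INR (S N) * v)).
Proof.
assert (St : forall K, todd v * exp (- (INR K * v)) =
  v * exp (- (INR (S K) * v)) + todd v * exp (- (INR (S K) * v))).
{ intros K.
  replace (v * exp (- (INR (S K) * v)))
    with (todd v * (exp v - 1) * exp (- (INR (S K) * v))) by now rewrite todd_mult.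
  replace (exp (- (INR K * v))) with (exp v * exp (- (INR (S K) * v))).
  - ring.
  - rewrite <- exp_plus; f_equal; rewrite S_INR; ring. }
induction N as [|N IH].
- cbn [sum_f_R0]; rewrite <- (St 0%nat).
  simpl; rewrite Rmult_0_l, Ropp_0, exp_0; ring.
- rewrite tech5, Rplus_assoc, <- (St (S N)); exact IH.
Qed.

Lemma continuous_pow_mult_todd (k : nat) (v : R) :
  continuous (fun v => v ^ k * todd v) v.
Proof.
apply (continuous_mult (K := R_AbsRing)); [|apply continuous_todd].
apply continuous_of_ex_derive; intros y; auto_derive; auto.
Qed.

Lemma continuous_pow_todd_exp (c : R) (k : nat) (v : R) :
  continuous (fun v => v ^ k * todd v * exp (- (c * v))) v.
Proof.
apply (continuous_mult (K := R_AbsRing)); [apply continuous_pow_mult_todd|].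
apply continuous_of_ex_derive; intros y; auto_derive; auto.
Qed.

Lemma RInt_pow_todd (k N : nat) (b : R) :
  RInt (fun v => v ^ k * todd v) 0 b =
  RInt (fun v => sum_f_R0 (fun i => v ^ S k * exp (- (INR (S i) * v))) N) 0 b
  + RInt (fun v => v ^ k * todd v * exp (- (INR (S N) * v))) 0 b.
Proof.
rewrite <- (RInt_plus (V := R_CompleteNormedModule)).
- apply RInt_ext; intros v _.
  change (v ^ k * todd v = sum_f_R0 (fun i => v ^ S k * exp (- (INR (S i) * v))) N
            + v ^ k * todd v * exp (- (INR (S N) * v)) :> R).
  rewrite (todd_geometric N v) at 1; rewrite Rmult_plus_distr_l, scal_sum.
  f_equal; [apply sum_eq; intros i _; simpl; ring|ring].
- apply ex_RInt_continuous_all.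
  apply (halfline_sum (fun i v => v ^ S k * exp (- (INR (S i) * v)))
           (fun i => INR (fact (S k)) / INR (S i) ^ S (S k)) N).
  intros i _; apply halfline_pow_exp, lt_0_INR; lia.
- apply ex_RInt_continuous_all, continuous_pow_todd_exp.
Qed.

(** With [todd <= 1], the remainder of the geometric expansion is dominated by a
    Gamma integral with rate [m = N + 1], uniformly in [b]. *)
Lemma RInt_pow_todd_remainder (k N : nat) (b : R) :
  0 <= b ->
  0 <= RInt (fun v => v ^ k * todd v * exp (- (INR (S N) * v))) 0 b
    <= INR (fact k) / INR (S N).
Proof.
intros Hb.
assert (P : 1 <= INR (S N)) by (apply (le_INR 1); lia).
split.
- apply RInt_ge_0; [exact Hb|apply ex_RInt_continuous_all, continuous_pow_todd_exp|].
  intros v Hv; apply Rmult_le_pos; [|left; apply exp_pos].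
  apply Rmult_le_pos; [apply pow_le; lra|apply todd_bounds; lra].
- eapply Rle_trans; [|eapply Rle_trans].
  2: apply (RInt_pow_exp_le (INR (S N)) k b); lra.
  + apply RInt_le; [exact Hb|apply ex_RInt_continuous_all, continuous_pow_todd_exp| |].
    * apply ex_RInt_continuous_all, halfline_pow_exp; lra.
    * intros v Hv; apply Rmult_le_compat_r; [left; apply exp_pos|].
      rewrite <- (Rmult_1_r (v ^ k)) at 2.
      apply Rmult_le_compat_l; [apply pow_le; lra|apply todd_bounds; lra].
  + apply Rmult_le_compat_l; [apply pos_INR|].
    apply Rinv_le_contravar; [lra|].
    rewrite <- (pow_1 (INR (S N))) at 1; apply Rle_pow; [exact P|lia].
Qed.

(** The Bose integral [int_0^oo v^(k+1) / (e^v - 1) dv].  Series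
    and integral are exchanged by squeezing: the integral up to [b] lies below
    [(k+1)! zeta (k+2)] up to a remainder that is uniform in [b], and above each
    partial sum of the integrated series. *)
Lemma halfline_pow_todd (k : nat) :
  is_halfline_RInt (fun v => v ^ k * todd v) (INR (fact (S k)) * zeta (S (S k))).
Proof.
pose (c := INR (fact (S k))).
assert (Pc : 0 < c) by apply INR_fact_lt_0.
assert (Pk : 0 < INR (fact k)) by apply INR_fact_lt_0.
assert (Hz := is_lim_seq_zeta (S (S k)) ltac:(lia)).
assert (HS : forall N,
  is_halfline_RInt (fun v => sum_f_R0 (fun i => v ^ S k * exp (- (INR (S i) * v))) N)
    (c * sum_f_R0 (fun i => / INR (S i) ^ S (S k)) N)).
{ intros N; rewrite scal_sum.
  apply (halfline_sum (fun i v => v ^ S k * exp (- (INR (S i) * v)))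
           (fun i => / INR (S i) ^ S (S k) * c) N).
  intros i _; rewrite Rmult_comm.
  apply halfline_pow_exp, lt_0_INR; lia. }
split; [intros v; apply continuous_pow_mult_todd|].
assert (Up : forall b, 0 <= b ->
  RInt (fun v => v ^ k * todd v) 0 b <= c * zeta (S (S k))).
{ intros b Hb.
  assert (L : is_lim_seq (fun N => c * zeta (S (S k)) + INR (fact k) * / INR (S N))
                (c * zeta (S (S k)))).
  { replace (Finite (c * zeta (S (S k))))
      with (Finite (c * zeta (S (S k)) + 0)) by (f_equal; ring).
    apply is_lim_seq_plus'; [apply is_lim_seq_const|].
    replace (Finite 0) with (Rbar_mult (INR (fact k)) (Rbar_inv p_infty))
      by (simpl; f_equal; ring).
    apply is_lim_seq_scal_l, is_lim_seq_inv; [|discriminate].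
    apply (is_lim_seq_incr_1 INR), is_lim_seq_INR. }
  refine (is_lim_seq_le (fun _ => RInt (fun v => v ^ k * todd v) 0 b)
    _ _ _ _ (is_lim_seq_const _) L); intros N.
  rewrite (RInt_pow_todd k N b).
  apply Rplus_le_compat; [|now apply RInt_pow_todd_remainder].
  apply Rle_trans with (c * sum_f_R0 (fun i => / INR (S i) ^ S (S k)) N).
  - rewrite scal_sum, (is_RInt_unique (V := R_CompleteNormedModule) _ _ _ _
      (RInt_sum (fun i v => v ^ S k * exp (- (INR (S i) * v))) 0 b N
        ltac:(intros i; apply ex_RInt_continuous_all,
                halfline_pow_exp, lt_0_INR; lia))).
    apply sum_Rle; intros i _; rewrite (Rmult_comm _ c).
    apply RInt_pow_exp_le; [apply lt_0_INR; lia|exact Hb].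
  - apply Rmult_le_compat_l; [lra|apply zeta_partial_le; lia]. }
(* The partial sum is chosen first, up to [eps / 2], and then [b], so that the
   finitely many integrals of this partial sum are close to their limits. *)
apply is_lim_spec; intros eps.
assert (Pe : 0 < eps / (2 * c)) by (apply Rdiv_lt_0_compat; [apply eps|lra]).
destruct (proj2 (is_lim_seq_spec _ _) Hz (mkposreal _ Pe)) as [N HN].
specialize (HN N (le_n N)); cbn [pos] in HN.
destruct (proj2 (is_lim_spec _ _ _) (proj2 (HS N)) (pos_div_2 eps)) as [M HM].
exists (Rmax M 0); intros b Hb.
assert (b0 : 0 <= b) by (eapply Rle_trans; [apply Rmax_r|left; exact Hb]).
assert (bM : M < b) by (eapply Rle_lt_trans; [apply Rmax_l|exact Hb]).
specialize (HM b bM); specialize (Up b b0).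
assert (R0 := RInt_pow_todd_remainder k N b b0).
assert (E := RInt_pow_todd k N b).
cbn [pos pos_div_2] in HM.
apply Rabs_def2 in HM; apply Rabs_def2 in HN.
set (s := sum_f_R0 (fun i => / INR (S i) ^ S (S k)) N) in *.
assert (Q : c * (zeta (S (S k)) - s) < eps / 2).
{ replace (eps / 2) with (c * (eps / (2 * c))) by (field; lra).
  apply Rmult_lt_compat_l; [exact Pc|].
  lra. }
fold c in Up |- *; assert (T := cond_pos eps); apply Rabs_def1; lra.
Qed.

(** The Fermi function at zero chemical potential. *)
Definition fermi (v : R) : R := / (1 + exp v).

(** The values of [int_0^oo v^k / (1 + e^v) dv]. *)
Definition fermi_moment (k : nat) : R :=
  match k with
  | O => ln 2
  | S _ => (1 - / 2 ^ k) * INR (fact k) * zeta (S k)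
  end.

Lemma continuous_fermi (v : R) : continuous fermi v.
Proof.
apply continuous_of_ex_derive; intros y; unfold fermi; auto_derive.
assert (P := exp_pos y); lra.
Qed.

Lemma continuous_pow_fermi (k : nat) (v : R) :
  continuous (fun v => v ^ k * fermi v) v.
Proof.
apply (continuous_mult (K := R_AbsRing)); [|apply continuous_fermi].
apply continuous_of_ex_derive; intros y; auto_derive; auto.
Qed.

(** This is [1 / (e^v + 1) = 1 / (e^v - 1) - 2 / (e^(2v) - 1)]; it reduces the
    Fermi moments to Bose integrals by a dilation. *)
Lemma fermi_todd (v : R) : v * fermi v = todd v - todd (2 * v).
Proof.
destruct (Req_EM_T v 0) as [->|H].
- rewrite Rmult_0_r, todd_0; ring.
- rewrite !todd_neq by lra; unfold fermi.
  assert (N := exp_minus_1_neq_0 v H); assert (P := exp_pos v).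
  replace (exp (2 * v)) with (exp v * exp v)
    by (rewrite <- exp_plus; f_equal; ring).
  field; repeat split; try lra.
  replace (exp v * exp v - 1) with ((exp v - 1) * (exp v + 1)) by ring.
  apply Rmult_integral_contrapositive_currified; lra.
Qed.

(** For [k = 0] the function [- ln (1 + e^(-v))] is a primitive; the other moments
    follow from [fermi_todd]. *)
Lemma halfline_pow_fermi (k : nat) :
  is_halfline_RInt (fun v => v ^ k * fermi v) (fermi_moment k).
Proof.
destruct k as [|k].
- split; [intros v; apply continuous_pow_fermi|].
  apply is_lim_ext with (fun b => ln 2 + - ln (1 + exp (- b))).
  { intros b; symmetry.
    apply (is_RInt_unique (V := R_CompleteNormedModule)).
    assert (E2 : 1 + exp (- 0) = 2) by (rewrite Ropp_0, exp_0; ring).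
    replace (ln 2 + - ln (1 + exp (- b)))
      with (minus (- ln (1 + exp (- b))) (- ln (1 + exp (- 0)))).
    - apply (is_RInt_derive (V := R_CompleteNormedModule)
               (fun b => - ln (1 + exp (- b)))).
      + intros x _; unfold fermi; assert (P := exp_pos (- x)).
        auto_derive; [lra|].
        assert (Q := exp_pos x); rewrite exp_Ropp; field; lra.
      + intros x _; apply continuous_pow_fermi.
    - rewrite E2; unfold minus, plus, opp; simpl; ring. }
  simpl fermi_moment.
  replace (Finite (ln 2)) with (Finite (ln 2 + - ln (1 + 0)))
    by (rewrite Rplus_0_r, ln_1; f_equal; ring).
  apply is_lim_plus'; [apply is_lim_const|].
  apply (is_lim_opp (fun b => ln (1 + exp (- b))) p_infty (ln (1 + 0))).
  apply (is_lim_comp_continuous (fun b => exp (- b)) (fun y => ln (1 + y))).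
  + apply is_lim_ext with (fun v => v ^ 0 * exp (- (1 * v))).
    { intros v; rewrite !Rmult_1_l; reflexivity. }
    apply is_lim_pow_exp; lra.
  + apply (ex_derive_continuous (K := R_AbsRing) (V := R_NormedModule)
             (fun y => ln (1 + y)) 0).
    auto_derive; lra.
- cbn [fermi_moment].
  replace ((1 - / 2 ^ S k) * INR (fact (S k)) * zeta (S (S k)))
    with (INR (fact (S k)) * zeta (S (S k))
      + (- / 2 ^ k) * (/ 2 * (RInt (fun v => v ^ k * todd v) 0 0
          + INR (fact (S k)) * zeta (S (S k))))).
  + apply halfline_ext with
      (fun v => v ^ k * todd v
         + (- / 2 ^ k) * ((2 * v + 0) ^ k * todd (2 * v + 0))).
    * intros v; rewrite Rplus_0_r.
      replace (v ^ S k * fermi v) with (v ^ k * (v * fermi v)) by (simpl; ring).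
      rewrite fermi_todd, Rpow_mult_distr; field.
      apply pow_nonzero; lra.
    * apply halfline_plus; [apply halfline_pow_todd|].
      apply halfline_scal.
      apply (halfline_affine 2 0 (fun v => v ^ k * todd v)); [lra|].
      apply halfline_pow_todd.
  + rewrite RInt_point; unfold zero; simpl (_ 0%R).
    change (2 ^ S k) with (2 * 2 ^ k).
    simpl; field; apply pow_nonzero; lra.
Qed.

(** * Partial fractions of the hyperbolic cotangent *)

(** The Dirichlet kernel for the cosine series on [[0, 1]]; the sum runs over the
    frequencies [1], ..., [N + 1]. *)
Definition dirichlet (N : nat) (x : R) : R :=
  1 + 2 * sum_f_R0 (fun k => cos (INR (S k) * (PI * x))) N.

Lemma sin_mult_dirichlet (N : nat) (x : R) :
  sin (PI * x / 2) * dirichlet N x = sin ((INR N + 3 / 2) * PI * x).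
Proof.
set (y := PI * x / 2).
assert (St : forall s, 2 * (sin y * cos (s * (PI * x))) =
  sin (s * (PI * x) + y) - sin (s * (PI * x) - y)).
{ intros s; rewrite sin_plus, sin_minus; ring. }
unfold dirichlet; induction N as [|N IH].
- cbn [sum_f_R0]; rewrite Rmult_plus_distr_l.
  replace (sin y * (2 * cos (INR 1 * (PI * x))))
    with (2 * (sin y * cos (INR 1 * (PI * x)))) by ring.
  rewrite St; simpl INR.
  replace (1 * (PI * x) - y) with y by (unfold y; field).
  rewrite Rmult_1_r, Rplus_minus; f_equal; unfold y; field.
- rewrite tech5.
  transitivity (sin y * (1 + 2 * sum_f_R0 (fun k => cos (INR (S k) * (PI * x))) N)
    + 2 * (sin y * cos (INR (S (S N)) * (PI * x)))); [ring|].
  rewrite IH, St.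
  replace (INR (S (S N)) * (PI * x) - y) with ((INR N + 3 / 2) * PI * x)
    by (unfold y; rewrite !S_INR; field).
  rewrite Rplus_minus; f_equal; unfold y; rewrite !S_INR; field.
Qed.

Lemma continuous_dirichlet (N : nat) (x : R) : continuous (dirichlet N) x.
Proof.
apply continuous_of_ex_derive; intros y; unfold dirichlet.
assert (H : ex_derive
  (fun x => sum_f_R0 (fun k => cos (INR (S k) * (PI * x))) N) y).
{ induction N as [|N IH]; cbn [sum_f_R0].
  - auto_derive; auto.
  - apply (ex_derive_plus (V := R_NormedModule)); [exact IH|auto_derive; auto]. }
apply (ex_derive_plus (V := R_NormedModule)); [apply ex_derive_const|].
now apply ex_derive_scal.
Qed.

Lemma bounded_on_segment (f : R -> R) (a b : R) :
  (forall x, a <= x <= b -> continuous f x) ->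
  exists M, 0 < M /\ forall x, a <= x <= b -> Rabs (f x) <= M.
Proof.
intros H; destruct (bounded_continuity (V := R_NormedModule) f a b H) as [M HM].
exists (Rmax M 1); split; [eapply Rlt_le_trans; [apply Rlt_0_1|apply Rmax_r]|].
intros x Hx; eapply Rle_trans; [left; apply (HM x Hx)|apply Rmax_l].
Qed.

(** The Riemann-Lebesgue lemma for a function of class C^1, with rate: an
    integration by parts gains a factor [1 / w]. *)
Lemma riemann_lebesgue (g dg : R -> R) (a b : R) :
  a <= b ->
  (forall x, a <= x <= b -> is_derive g x (dg x)) ->
  (forall x, a <= x <= b -> continuous dg x) ->
  exists K, 0 < K /\ forall w, 0 < w ->
    Rabs (RInt (fun x => g x * sin (w * x)) a b) <= K / w.
Proof.
intros Hab Hg Hdg.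
destruct (bounded_on_segment dg a b Hdg) as [M [M0 HM]].
exists (Rabs (g a) + Rabs (g b) + (b - a) * M + 1).
assert (Pa := Rabs_pos (g a)); assert (Pb := Rabs_pos (g b)).
assert (Pm : 0 <= (b - a) * M) by (apply Rmult_le_pos; lra).
split; [lra|]; intros w Hw.
assert (Cc : forall x, a <= x <= b -> continuous (fun x => dg x * (cos (w * x) / w)) x).
{ intros x Hx; apply (continuous_mult (K := R_AbsRing)); [now apply Hdg|].
  apply continuous_of_ex_derive; intros y; auto_derive; auto. }
assert (Hc : forall x, Rmin a b <= x <= Rmax a b -> a <= x <= b)
  by (rewrite Rmin_left, Rmax_right by lra; auto).
assert (Ex : ex_RInt (fun x => dg x * (cos (w * x) / w)) a b).
{ apply (ex_RInt_continuous (V := R_CompleteNormedModule)); auto. }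
assert (I : is_RInt (fun x => g x * sin (w * x)) a b
  ((g a * (cos (w * a) / w) - g b * (cos (w * b) / w))
   + RInt (fun x => dg x * (cos (w * x) / w)) a b)).
{ apply is_RInt_ext with (fun x =>
    plus (opp (dg x * (cos (w * x) / w) - g x * sin (w * x)))
         (dg x * (cos (w * x) / w))).
  { intros x _; unfold plus, opp; simpl; ring. }
  apply (is_RInt_plus (V := R_NormedModule));
    [|apply (RInt_correct (V := R_CompleteNormedModule)), Ex].
  replace (g a * (cos (w * a) / w) - g b * (cos (w * b) / w))
    with (opp (minus (g b * (cos (w * b) / w)) (g a * (cos (w * a) / w))))
    by (unfold minus, plus, opp; simpl; ring).
  apply (is_RInt_opp (V := R_NormedModule)).
  apply (is_RInt_derive (V := R_CompleteNormedModule)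
           (fun x => g x * (cos (w * x) / w))).
  - intros x Hx.
    replace (dg x * (cos (w * x) / w) - g x * sin (w * x))
      with (plus (mult (dg x) (cos (w * x) / w))
                 (mult (g x) (- (w * sin (w * x)) / w)))
      by (unfold plus, mult; simpl; field; lra).
    apply (is_derive_mult (K := R_AbsRing) g (fun x => cos (w * x) / w));
      [now apply Hg, Hc| |apply Rmult_comm].
    auto_derive; [auto|field; lra].
  - intros x Hx; apply (continuous_minus (V := R_NormedModule)); [now apply Cc, Hc|].
    apply (continuous_mult (K := R_AbsRing)).
    + apply (ex_derive_continuous (K := R_AbsRing) (V := R_NormedModule)).
      exists (dg x); now apply Hg, Hc.
    + apply continuous_of_ex_derive; intros y; auto_derive; auto. }
rewrite (is_RInt_unique (V := R_CompleteNormedModule) _ _ _ _ I).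
assert (Bc : forall c x, Rabs (c * (cos (w * x) / w)) <= Rabs c / w).
{ intros c x; unfold Rdiv; rewrite !Rabs_mult, (Rabs_pos_eq (/ w))
    by (left; now apply Rinv_0_lt_compat).
  apply Rmult_le_compat_l; [apply Rabs_pos|].
  rewrite <- (Rmult_1_l (/ w)) at 2; apply Rmult_le_compat_r.
  - left; now apply Rinv_0_lt_compat.
  - apply Rabs_le, COS_bound. }
assert (B3 : Rabs (RInt (fun x => dg x * (cos (w * x) / w)) a b) <= (b - a) * (M / w)).
{ apply abs_RInt_le_const; [exact Hab|exact Ex|].
  intros x Hx; eapply Rle_trans; [apply Bc|].
  apply Rmult_le_compat_r; [left; now apply Rinv_0_lt_compat|now apply HM]. }
eapply Rle_trans; [apply Rabs_triang|].
eapply Rle_trans; [apply Rplus_le_compat; [apply Rabs_triang|exact B3]|].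
rewrite Rabs_Ropp.
assert (B1 := Bc (g a) a); assert (B2 := Bc (g b) b).
assert (P1 : 0 < / w) by now apply Rinv_0_lt_compat.
replace ((Rabs (g a) + Rabs (g b) + (b - a) * M + 1) / w)
  with (Rabs (g a) / w + Rabs (g b) / w + (b - a) * (M / w) + / w) by (field; lra).
lra.
Qed.

(** By the mean value theorem, since [cos >= 1/2] on [[0, pi/3]]. *)
Lemma sin_ge_half (y : R) : 0 <= y <= 1 -> y / 2 <= sin y.
Proof.
intros Hy; assert (P := PI2_3_2).
destruct (MVT_gen sin 0 y cos) as [c [Hc E]].
- intros x _; apply is_derive_Reals, derivable_pt_lim_sin.
- intros x _; apply continuity_sin.
- rewrite Rmin_left, Rmax_right in Hc by lra.
  rewrite sin_0, !Rminus_0_r in E; rewrite E.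
  assert (/ 2 <= cos c); [|nra].
  replace (/ 2) with (cos (PI / 3)) by (rewrite cos_PI3; lra).
  apply cos_decr_1; lra.
Qed.

(** A function that vanishes at [0] has a cosine series that sums to [0] there.
    Near [0] the quotient [h x / sin (pi x / 2)] is bounded, so that a short
    segment [[0, d]] contributes little, whatever [N] is; on [[d, 1]] the quotient
    is of class C^1 and the Riemann-Lebesgue lemma applies. *)
Lemma dirichlet_localization (h dh : R -> R) :
  (forall x, is_derive h x (dh x)) -> (forall x, continuous dh x) -> h 0 = 0 ->
  is_lim_seq (fun N => RInt (fun x => h x * dirichlet N x) 0 1) 0.
Proof.
intros Hh Hdh h0; apply is_lim_seq_spec; intros eps.
assert (He := cond_pos eps).
assert (P3 := PI2_3_2); assert (P4 := PI_4).
assert (Ch : forall x, continuous h x)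
  by (apply continuous_of_ex_derive; intros x; eexists; apply Hh).
assert (Cd : forall N x, continuous (fun x => h x * dirichlet N x) x)
  by (intros N x; apply (continuous_mult (K := R_AbsRing));
      [apply Ch|apply continuous_dirichlet]).
destruct (bounded_on_segment dh (-1) 1 ltac:(auto)) as [K [K0 HK]].
assert (Bh : forall x, 0 <= x <= 1 -> Rabs (h x) <= K * x).
{ intros x Hx.
  assert (V := bounded_variation h dh K 0 x).
  rewrite h0, !Rminus_0_r, (Rabs_pos_eq x) in V by lra.
  apply V; intros s Hs; split; [apply Hh|apply HK].
  rewrite Rminus_0_r in Hs; apply Rabs_le_between in Hs; lra. }
(* On [0, d] the integrand is at most [K x / (x / 2) = 2 K], which makes the
   integral over [0, d] at most [eps / 2]. *)
pose (d := Rmin (/ 2) (eps / (4 * K))).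
assert (d0 : 0 < d)
  by (apply Rmin_pos; [lra|apply Rdiv_lt_0_compat; lra]).
assert (d1 : d <= / 2) by apply Rmin_l.
assert (dK : d * (2 * K) <= eps / 2).
{ replace (eps / 2) with (eps / (4 * K) * (2 * K)) by (field; lra).
  apply Rmult_le_compat_r; [lra|apply Rmin_r]. }
assert (Ps : forall x, d <= x <= 1 -> 0 < sin (PI * x / 2)).
{ intros x Hx; apply sin_gt_0; nra. }
destruct (riemann_lebesgue (fun x => h x / sin (PI * x / 2))
  (fun x => (dh x * sin (PI * x / 2) - h x * (PI / 2 * cos (PI * x / 2)))
            / (sin (PI * x / 2)) ^ 2) d 1) as [L [L0 HL]].
- lra.
- intros x Hx; apply (is_derive_div h (fun x => sin (PI * x / 2)));
    [apply Hh| |apply Rgt_not_eq, Ps, Hx].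
  auto_derive; [auto|unfold Rdiv; ring].
- intros x Hx; apply (continuous_mult (K := R_AbsRing)).
  + apply (continuous_minus (V := R_NormedModule));
      apply (continuous_mult (K := R_AbsRing)); auto;
      apply continuous_of_ex_derive; intros y; auto_derive; auto.
  + apply (ex_derive_continuous (K := R_AbsRing) (V := R_NormedModule)
             (fun x => / sin (PI * x / 2) ^ 2) x).
    auto_derive; apply (pow_nonzero _ 2), Rgt_not_eq, Ps, Hx.
- destruct (INR_unbounded (L / (eps / 2))) as [N0 HN0].
  exists N0; intros N HN.
  rewrite Rminus_0_r, <- (RInt_Chasles (V := R_CompleteNormedModule) _ 0 d 1)
    by apply ex_RInt_continuous_all, Cd.
  eapply Rle_lt_trans; [apply Rabs_triang|].
  assert (B1 : Rabs (RInt (fun x => h x * dirichlet N x) 0 d) <= d * (2 * K)).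
  { rewrite <- (Rminus_0_r d) at 2; apply abs_RInt_le_const;
      [lra|apply ex_RInt_continuous_all, Cd|].
    intros x Hx; rewrite Rabs_mult.
    destruct (Req_dec x 0) as [->|Nx]; [rewrite h0, Rabs_R0; lra|].
    assert (S1 : x / 2 <= sin (PI * x / 2))
      by (eapply Rle_trans; [|apply sin_ge_half]; nra).
    assert (S2 : sin (PI * x / 2) * Rabs (dirichlet N x) <= 1).
    { rewrite <- (Rabs_pos_eq (sin (PI * x / 2))) by lra.
      rewrite <- Rabs_mult, sin_mult_dirichlet; apply Rabs_le, SIN_bound. }
    assert (Q := Rabs_pos (dirichlet N x)).
    apply Rle_trans with (K * x * Rabs (dirichlet N x)).
    - apply Rmult_le_compat_r; [exact Q|apply Bh; lra].
    - assert (x / 2 * Rabs (dirichlet N x) <= 1); [|nra].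
      eapply Rle_trans; [apply Rmult_le_compat_r; [exact Q|exact S1]|exact S2]. }
  assert (B2 : Rabs (RInt (fun x => h x * dirichlet N x) d 1) < eps / 2).
  { rewrite (RInt_ext _
      (fun x => h x / sin (PI * x / 2) * sin ((INR N + 3 / 2) * PI * x))).
    - assert (Hw : INR N0 < (INR N + 3 / 2) * PI)
        by (assert (T := le_INR _ _ HN); assert (T0 := pos_INR N); nra).
      assert (T0 := pos_INR N0).
      eapply Rle_lt_trans; [apply HL; lra|].
      apply Rlt_div_l; [lra|].
      apply Rlt_div_l in HN0; [|lra].
      eapply Rlt_trans; [exact HN0|].
      rewrite Rmult_comm; apply Rmult_lt_compat_l; lra.
    - intros x; rewrite Rmin_left, Rmax_right by lra; intros Hx.
      rewrite <- sin_mult_dirichlet.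
      change (h x * dirichlet N x =
        h x / sin (PI * x / 2) * (sin (PI * x / 2) * dirichlet N x) :> R).
      field; apply Rgt_not_eq, Ps; lra. }
  lra.
Qed.

Lemma sin_INR_PI (m : nat) : sin (INR m * PI) = 0.
Proof. apply sin_eq_0_1; exists (Z.of_nat m); now rewrite <- INR_IZR_INZ. Qed.

(** The cosine coefficients of [cosh (t (1 - x)) - cosh t]; the constant
    [cosh t], which makes the function vanish at [0], does not contribute to them. *)
Lemma RInt_cosh_cos (t : R) (m : nat) :
  t <> 0 -> (1 <= m)%nat ->
  is_RInt (fun x => (cosh (t * (1 - x)) - cosh t) * cos (INR m * (PI * x))) 0 1
    (t * sinh t / (t ^ 2 + (INR m * PI) ^ 2)).
Proof.
intros Ht Hm.
assert (Pm : 0 < INR m * PI) by (apply Rmult_lt_0_compat; [apply lt_0_INR; lia|apply PI_RGT_0]).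
assert (Pt : 0 < t ^ 2) by (apply pow2_gt_0, Ht).
pose (F := fun x =>
  (- (t * sinh (t * (1 - x)) * cos (INR m * (PI * x)))
   + INR m * PI * (cosh (t * (1 - x)) * sin (INR m * (PI * x))))
  / (t ^ 2 + (INR m * PI) ^ 2)
  - cosh t * (sin (INR m * (PI * x)) / (INR m * PI))).
assert (PP := PI_RGT_0).
assert (Nm : INR m <> 0) by (apply not_0_INR; lia).
assert (N2 : t ^ 2 + (INR m * PI) ^ 2 <> 0) by nra.
replace (t * sinh t / (t ^ 2 + (INR m * PI) ^ 2)) with (minus (F 1) (F 0)).
- apply (is_RInt_derive (V := R_CompleteNormedModule) F).
  + intros x _; unfold F, cosh, sinh; auto_derive; [auto|].
    simpl in N2; unfold Rminus; field; repeat split; auto; lra.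
  + intros x _; apply continuous_of_ex_derive; intros y.
    unfold cosh; auto_derive; auto.
- unfold F, minus, plus, opp; simpl.
  rewrite !Rmult_0_r, !Rmult_1_r, !Rminus_0_r, !Rmult_1_r, Rminus_diag, Rmult_0_r.
  rewrite sin_INR_PI, sinh_0, sin_0, cos_0; simpl in N2; field.
  repeat split; auto; lra.
Qed.

Lemma sinh_neq_0 (t : R) : t <> 0 -> sinh t <> 0.
Proof.
intros Ht E; unfold sinh in E.
assert (T : t = - t) by (apply exp_inv; lra); lra.
Qed.

(** The partial fraction expansion of the hyperbolic cotangent: the cosine
    coefficients of [h x = cosh (t (1 - x)) - cosh t] sum to [h 0 = 0]. *)
Lemma is_series_coth (t : R) :
  t <> 0 ->
  is_series (fun k => 2 * (t ^ 2 / (t ^ 2 + (INR (S k) * PI) ^ 2)))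
            (t * cosh t / sinh t - 1).
Proof.
intros Ht; assert (Ns := sinh_neq_0 t Ht).
pose (h := fun x => cosh (t * (1 - x)) - cosh t).
pose (c := fun k => t * sinh t / (t ^ 2 + (INR (S k) * PI) ^ 2)).
assert (I0 : is_RInt h 0 1 (sinh t / t - cosh t)).
{ replace (sinh t / t - cosh t)
    with (minus (- sinh (t * (1 - 1)) / t - cosh t * 1)
                (- sinh (t * (1 - 0)) / t - cosh t * 0)).
  - apply (is_RInt_derive (V := R_CompleteNormedModule)
             (fun x => - sinh (t * (1 - x)) / t - cosh t * x)).
    + intros x _; unfold h, cosh, sinh; auto_derive; [auto|].
      unfold Rminus; field; exact Ht.
    + intros x _; apply continuous_of_ex_derive; intros y.
      unfold h, cosh; auto_derive; auto.
  - unfold minus, plus, opp; simpl.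
    replace (t * (1 - 1)) with 0 by ring; replace (t * (1 - 0)) with t by ring.
    rewrite sinh_0; field; exact Ht. }
assert (I : forall N, is_RInt (fun x => h x * dirichlet N x) 0 1
              (sinh t / t - cosh t + 2 * sum_f_R0 c N)).
{ intros N.
  apply is_RInt_ext with (fun x => plus (h x)
    (scal 2 (sum_f_R0 (fun k => h x * cos (INR (S k) * (PI * x))) N))).
  - intros x _; unfold plus, scal, dirichlet; simpl plus; simpl scal.
    unfold mult; simpl mult.
    replace (sum_f_R0 (fun k => h x * cos (INR (S k) * (PI * x))) N)
      with (h x * sum_f_R0 (fun k => cos (INR (S k) * (PI * x))) N).
    + change (h x + 2 * (h x * sum_f_R0 (fun k => cos (INR (S k) * (PI * x))) N)
        = h x * (1 + 2 * sum_f_R0 (fun k => cos (INR (S k) * (PI * x))) N) :> R).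
      ring.
    + rewrite scal_sum; apply sum_eq; intros i _; ring.
  - apply (is_RInt_plus (V := R_NormedModule)); [exact I0|].
    apply (is_RInt_scal (V := R_NormedModule)).
    assert (J : forall k, is_RInt (fun x => h x * cos (INR (S k) * (PI * x))) 0 1 (c k))
      by (intros k; apply RInt_cosh_cos; [exact Ht|lia]).
    rewrite (sum_eq c (fun k => RInt (fun x => h x * cos (INR (S k) * (PI * x))) 0 1)).
    + apply (RInt_sum (fun k x => h x * cos (INR (S k) * (PI * x)))).
      intros k; exists (c k); apply J.
    + intros k _; symmetry; apply (is_RInt_unique (V := R_CompleteNormedModule)), J. }
assert (L : is_lim_seq (fun N => sinh t / t - cosh t + 2 * sum_f_R0 c N) 0).
{ apply is_lim_seq_ext with (fun N => RInt (fun x => h x * dirichlet N x) 0 1).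
  - intros N; apply (is_RInt_unique (V := R_CompleteNormedModule)), I.
  - apply dirichlet_localization with (fun x => - t * sinh (t * (1 - x))).
    + intros x; unfold h, cosh, sinh; auto_derive; [auto|].
      unfold Rminus; field.
    + intros x; apply continuous_of_ex_derive; intros y.
      unfold sinh; auto_derive; auto.
    + unfold h; rewrite Rminus_0_r, Rmult_1_r; ring. }
change (is_lim_seq (sum_n (fun k => 2 * (t ^ 2 / (t ^ 2 + (INR (S k) * PI) ^ 2))))
          (t * cosh t / sinh t - 1)).
apply (is_lim_seq_ext (fun N => t / sinh t * (sinh t / t - cosh t + 2 * sum_f_R0 c N)
                                + (t * cosh t / sinh t - 1))).
- intros N; rewrite sum_n_Reals.
  transitivity (2 * (t / sinh t) * sum_f_R0 c N); [field; auto|].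
  rewrite scal_sum; apply sum_eq; intros i _; unfold c.
  assert (0 < t ^ 2) by (apply pow2_gt_0, Ht).
  assert (t ^ 2 + (INR (S i) * PI) ^ 2 <> 0) by nra.
  field; auto.
- replace (Finite (t * cosh t / sinh t - 1))
    with (Finite (t / sinh t * 0 + (t * cosh t / sinh t - 1))) by (f_equal; ring).
  apply is_lim_seq_plus'; [|apply is_lim_seq_const].
  apply (is_lim_seq_scal_l _ (t / sinh t) 0 L).
Qed.

(** The expansion of [coth] at [t / 2], since
    [(t / 2) coth (t / 2) = t / (e^t - 1) + t / 2]. *)
Lemma is_series_todd (t : R) :
  t <> 0 ->
  is_series (fun k => 2 * (t ^ 2 / (t ^ 2 + (INR (S k) * (2 * PI)) ^ 2)))
            (t / (exp t - 1) + t / 2 - 1).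
Proof.
intros Ht.
assert (S2 := is_series_coth (t / 2) ltac:(lra)).
assert (Pt : 0 < t ^ 2) by (apply pow2_gt_0, Ht).
replace (t / (exp t - 1) + t / 2 - 1) with (t / 2 * cosh (t / 2) / sinh (t / 2) - 1).
- apply is_series_ext with (2 := S2); intros k.
  match goal with |- ?l = ?r => change (l = r :> R) end.
  assert (t ^ 2 + (INR (S k) * (2 * PI)) ^ 2 <> 0) by nra.
  assert ((t / 2) ^ 2 + (INR (S k) * PI) ^ 2 <> 0) by nra.
  replace (t ^ 2 + (INR (S k) * (2 * PI)) ^ 2)
    with (4 * ((t / 2) ^ 2 + (INR (S k) * PI) ^ 2)) by field.
  field; lra.
- f_equal; unfold cosh, sinh; rewrite exp_Ropp.
  assert (P := exp_pos (t / 2)).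
  assert (N := exp_minus_1_neq_0 t Ht); revert N.
  replace (exp t) with (exp (t / 2) * exp (t / 2))
    by (rewrite <- exp_plus; f_equal; field).
  intros N; field; repeat split; lra.
Qed.

(** * Bernoulli numbers and even zeta values *)

Lemma ball_0_Rabs (t : R) (e : posreal) : ball 0 e t <-> Rabs t < e.
Proof.
unfold ball; simpl; unfold AbsRing_ball, minus, plus, opp, abs; simpl.
now rewrite Ropp_0, Rplus_0_r.
Qed.

(** The coefficients of [(t / 2) coth (t / 2)] as a power series in [t^2]. *)
Definition zeta_coef (j : nat) : R :=
  match j with
  | O => 1
  | S i => 2 * (-1) ^ i * (zeta (2 * j) / (2 * PI) ^ (2 * j))
  end.

Lemma two_pi_gt_1 : 1 < 2 * PI.
Proof. assert (P := PI2_3_2); lra. Qed.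

Lemma is_series_zeta_coef (i : nat) (y : R) :
  is_series (fun k => 2 * (-1) ^ i * (y / (INR (S k) * (2 * PI)) ^ 2) ^ S i)
            (zeta_coef (S i) * y ^ S i).
Proof.
assert (P := two_pi_gt_1).
assert (H := is_series_scal_l (K := R_AbsRing)
  (2 * (-1) ^ i * (y ^ S i / (2 * PI) ^ (2 * S i))) _ _
  (Series_correct _ (ex_series_zeta (2 * S i) ltac:(lia)))).
replace (zeta_coef (S i) * y ^ S i)
  with (2 * (-1) ^ i * (y ^ S i / (2 * PI) ^ (2 * S i)) * zeta (2 * S i)).
- apply is_series_ext with (2 := H); intros k.
  change (2 * (-1) ^ i * (y ^ S i / (2 * PI) ^ (2 * S i)) * / INR (S k) ^ (2 * S i)
    = 2 * (-1) ^ i * (y / (INR (S k) * (2 * PI)) ^ 2) ^ S i :> R).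
  assert (Q : 0 < INR (S k)) by (apply lt_0_INR; lia).
  unfold Rdiv; rewrite (Rpow_mult_distr y), pow_inv, <- pow_mult,
    (Rpow_mult_distr (INR (S k))).
  field; split; apply pow_nonzero; lra.
- cbn [zeta_coef]; field; apply pow_nonzero; lra.
Qed.

(** Each fraction is [q / (1 + q)] with [q = y / (2 pi k)^2], and its expansion
    in powers of [q] is stopped after [J] terms with its exact remainder.  Working
    with finite expansions avoids the rearrangement of a double series. *)
Lemma is_series_zeta_coef_remainder (y s : R) (J : nat) :
  0 <= y ->
  is_series (fun k => 2 * (y / (y + (INR (S k) * (2 * PI)) ^ 2))) s ->
  is_series (fun k => let q := y / (INR (S k) * (2 * PI)) ^ 2 in
                      2 * (-1) ^ J * q ^ J * (q / (1 + q)))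
            (1 + s - sum_f_R0 (fun j => zeta_coef j * y ^ j) J).
Proof.
intros Hy Hs; assert (P := two_pi_gt_1).
assert (Pk : forall k, 0 < (INR (S k) * (2 * PI)) ^ 2)
  by (intros k; apply pow_lt, Rmult_lt_0_compat; [apply lt_0_INR; lia|lra]).
induction J as [|J IH].
- replace (1 + s - sum_f_R0 (fun j => zeta_coef j * y ^ j) 0) with s by (simpl; ring).
  apply is_series_ext with (2 := Hs); intros k; cbv zeta.
  match goal with |- ?l = ?r => change (l = r :> R) end.
  specialize (Pk k); set (w := (INR (S k) * (2 * PI)) ^ 2) in *; field; lra.
- rewrite tech5.
  replace (1 + s - (sum_f_R0 (fun j => zeta_coef j * y ^ j) J + zeta_coef (S J) * y ^ S J))
    with (plus (1 + s - sum_f_R0 (fun j => zeta_coef j * y ^ j) J)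
               (opp (zeta_coef (S J) * y ^ S J)))
    by (unfold plus, opp; simpl; ring).
  apply is_series_ext with
    (2 := is_series_minus _ _ _ _ IH (is_series_zeta_coef J y)).
  intros k; cbv zeta; specialize (Pk k).
  set (q := y / (INR (S k) * (2 * PI)) ^ 2).
  change (2 * (-1) ^ J * q ^ J * (q / (1 + q)) + - (2 * (-1) ^ J * q ^ S J)
    = 2 * (-1) ^ S J * q ^ S J * (q / (1 + q)) :> R).
  assert (0 <= q) by (apply Rdiv_le_0_compat; lra).
  rewrite <- !tech_pow_Rmult; field; lra.
Qed.

(** The remainder of order [J] is at most [2 y^J zeta 2], because [q <= y] and
    [q <= 1 / k^2]. *)
Lemma is_pseries_zeta_coef (y s : R) :
  0 <= y < 1 ->
  is_series (fun k => 2 * (y / (y + (INR (S k) * (2 * PI)) ^ 2))) s ->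
  is_pseries zeta_coef y (1 + s).
Proof.
intros Hy Hs; assert (P := two_pi_gt_1).
assert (B : forall J,
  Rabs (1 + s - sum_f_R0 (fun j => zeta_coef j * y ^ j) J) <= 2 * zeta 2 * y ^ J).
{ intros J.
  assert (Rm := is_series_zeta_coef_remainder y s J (proj1 Hy) Hs); cbv zeta in Rm.
  rewrite <- (is_series_unique _ _ Rm).
  assert (T : forall k, 0 <= Rabs (2 * (-1) ^ J * (y / (INR (S k) * (2 * PI)) ^ 2) ^ J
      * (y / (INR (S k) * (2 * PI)) ^ 2 / (1 + y / (INR (S k) * (2 * PI)) ^ 2)))
    <= 2 * y ^ J * / INR (S k) ^ 2).
  { intros k; split; [apply Rabs_pos|].
    assert (K1 : 1 <= INR (S k)) by (apply (le_INR 1); lia).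
    assert (Pk : 1 <= INR (S k) ^ 2) by nra.
    assert (Pw : INR (S k) ^ 2 <= (INR (S k) * (2 * PI)) ^ 2) by (apply pow_incr; nra).
    set (q := y / (INR (S k) * (2 * PI)) ^ 2).
    assert (q0 : 0 <= q) by (apply Rdiv_le_0_compat; lra).
    assert (q1 : q <= y) by (apply Rle_div_l; nra).
    assert (q2 : q <= / INR (S k) ^ 2).
    { apply Rle_trans with (1 * / (INR (S k) * (2 * PI)) ^ 2).
      - apply Rmult_le_compat_r; [left; apply Rinv_0_lt_compat|]; lra.
      - rewrite Rmult_1_l; apply Rinv_le_contravar; lra. }
    assert (q3 : q / (1 + q) <= q) by (apply Rle_div_l; nra).
    assert (q4 : 0 <= q / (1 + q)) by (apply Rdiv_le_0_compat; lra).
    rewrite !Rabs_mult, pow_1_abs, (Rabs_pos_eq 2), (Rabs_pos_eq (q / (1 + q))), Rmult_1_r,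
      <- RPow_abs, (Rabs_pos_eq q) by lra.
    apply Rmult_le_compat; [|exact q4| |lra].
    - apply Rmult_le_pos; [lra|now apply pow_le].
    - apply Rmult_le_compat_l; [lra|now apply pow_incr]. }
  assert (E2 : ex_series (fun k => 2 * y ^ J * / INR (S k) ^ 2))
    by (apply (ex_series_scal_l (K := R_AbsRing) (V := R_NormedModule) (2 * y ^ J)
           (fun k => / INR (S k) ^ 2)), ex_series_zeta; lia).
  eapply Rle_trans; [apply Series_Rabs|].
  - apply (ex_series_le (K := R_AbsRing) (V := R_CompleteNormedModule)) with (2 := E2).
    intros k; unfold norm; simpl norm; unfold abs; simpl abs.
    rewrite Rabs_Rabsolu; apply T.
  - eapply Rle_trans; [apply Series_le; [exact T|exact E2]|].
    rewrite Series_scal_l; unfold zeta; apply Req_le; ring. }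
change (is_lim_seq (sum_n (fun k => scal (pow_n y k) (zeta_coef k))) (1 + s)).
apply is_lim_seq_ext with (fun J => sum_f_R0 (fun j => zeta_coef j * y ^ j) J).
{ intros J; rewrite sum_n_Reals; apply sum_eq; intros i _.
  symmetry; rewrite Rmult_comm.
  exact (f_equal (Rmult (zeta_coef i)) (pow_n_pow y i)). }
assert (L : is_lim_seq (fun J => 2 * zeta 2 * y ^ J) 0).
{ replace (Finite 0) with (Rbar_mult (2 * zeta 2) 0) by (simpl; f_equal; ring).
  apply is_lim_seq_scal_l, is_lim_seq_geom; rewrite Rabs_pos_eq; lra. }
apply is_lim_seq_le_le with
  (fun J => 1 + s - 2 * zeta 2 * y ^ J) (fun J => 1 + s + 2 * zeta 2 * y ^ J).
- intros J; specialize (B J); apply Rabs_le_between in B; lra.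
- replace (Finite (1 + s)) with (Finite (1 + s - 0)) by (f_equal; ring).
  apply is_lim_seq_minus'; [apply is_lim_seq_const|exact L].
- replace (Finite (1 + s)) with (Finite (1 + s + 0)) by (f_equal; ring).
  apply is_lim_seq_plus'; [apply is_lim_seq_const|exact L].
Qed.

(** The Taylor coefficients of [t / (e^t - 1)]: those of [(t / 2) coth (t / 2)]
    at even indices, and the term [- t / 2] as the only odd one. *)
Definition todd_coef (n : nat) : R :=
  if Nat.even n then zeta_coef (Nat.div2 n)
  else if Nat.eqb n 1 then - / 2 else 0.

Lemma todd_coef_even (j : nat) : todd_coef (2 * j) = zeta_coef j.
Proof. unfold todd_coef; now rewrite Nat.even_even, Nat.div2_double. Qed.

Lemma is_pseries_todd_coef (t : R) :
  t <> 0 -> Rabs t < 1 -> is_pseries todd_coef t (t / (exp t - 1)).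
Proof.
intros Ht H1; apply Rabs_def2 in H1.
replace (t / (exp t - 1))
  with ((1 + (t / (exp t - 1) + t / 2 - 1)) + t * (- / 2)) by (unfold Rdiv; ring).
apply is_pseries_odd_even.
- apply is_pseries_ext with zeta_coef; [intros j; symmetry; apply todd_coef_even|].
  apply is_pseries_zeta_coef; [nra|].
  now apply is_series_todd.
- change (is_lim_seq
    (sum_n (fun k => scal (pow_n (t ^ 2) k) (todd_coef (2 * k + 1)))) (- / 2)).
  apply is_lim_seq_ext with (2 := is_lim_seq_const _); intros N.
  rewrite sum_n_Reals; induction N as [|N IH].
  + change (- / 2 = 1 * - / 2); ring.
  + rewrite tech5, <- IH.
    replace (todd_coef (2 * S N + 1)) with 0.
    * unfold scal; simpl; unfold mult; simpl; ring.
    * unfold todd_coef; rewrite Nat.even_odd.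
      rewrite (proj2 (Nat.eqb_neq _ _)); [reflexivity|lia].
Qed.

Lemma CV_radius_ge_of_ex_pseries (a : nat -> R) (x : R) :
  ex_pseries a x -> Rbar_le (Rabs x) (CV_radius a).
Proof.
intros H; apply Rbar_not_lt_le; intros L; apply (CV_disk_outside _ _ L).
apply is_lim_seq_ext with (2 := ex_series_lim_0 _ H); intros n.
unfold scal; simpl; unfold mult; simpl; rewrite pow_n_pow; ring.
Qed.

(** Power series that agree on a punctured neighbourhood agree at the centre by
    continuity, so that the uniqueness theorem on a full neighbourhood applies. *)
Lemma pseries_punctured_unique (a b : nat -> R) (f : R -> R) :
  locally' 0 (fun t => is_pseries a t (f t)) ->
  locally' 0 (fun t => is_pseries b t (f t)) ->
  forall n, a n = b n.
Proof.
intros Ha Hb.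
destruct (filter_and _ _ Ha Hb) as [e He].
assert (Pe := cond_pos e).
assert (H : forall t, t <> 0 -> Rabs t < e -> is_pseries a t (f t) /\ is_pseries b t (f t)).
{ intros t Nt Lt; apply He; [|exact Nt].
  now apply ball_0_Rabs. }
assert (Hr : forall c, ex_pseries c (e / 2) -> Rbar_lt 0 (CV_radius c)).
{ intros c Hc; apply Rbar_lt_le_trans with (Rabs (e / 2)).
  - simpl; apply Rabs_pos_lt; lra.
  - now apply CV_radius_ge_of_ex_pseries. }
destruct (H (e / 2)) as [A2 B2]; [lra|rewrite Rabs_pos_eq; lra|].
assert (Ra := Hr a (ex_intro _ _ A2)); assert (Rb := Hr b (ex_intro _ _ B2)).
assert (Eq : forall t, t <> 0 -> Rabs t < e -> PSeries a t = PSeries b t).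
{ intros t Nt Lt; destruct (H t Nt Lt) as [At Bt].
  now rewrite (is_pseries_unique _ _ _ At), (is_pseries_unique _ _ _ Bt). }
assert (E0 : PSeries a 0 = PSeries b 0).
{ assert (La : is_lim (PSeries a) 0 (PSeries a 0))
    by (apply is_lim_continuity, PSeries_continuity; now rewrite Rabs_R0).
  assert (Lb : is_lim (PSeries b) 0 (PSeries b 0))
    by (apply is_lim_continuity, PSeries_continuity; now rewrite Rabs_R0).
  assert (Lc : is_lim (PSeries a) 0 (PSeries b 0)).
  { apply is_lim_ext_loc with (2 := Lb); exists e; intros t Bt Nt.
    symmetry; apply Eq; [exact Nt|].
    now apply ball_0_Rabs. }
  apply is_lim_unique in La; apply is_lim_unique in Lc.
  rewrite La in Lc; now injection Lc. }
intros n; apply PSeries_ext_recip; [exact Ra|exact Rb|].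
exists e; intros t Bt; destruct (Req_dec t 0) as [->|Nt]; [exact E0|].
apply Eq; [exact Nt|].
now apply ball_0_Rabs.
Qed.

(** Euler's formula for [zeta (2 j)], solved for the Bernoulli number. *)
Lemma bernoulli_even (B : nat -> R -> R) (j : nat) :
  bernoulli_polynomials B ->
  B (2 * j)%nat 0 = INR (fact (2 * j)) * zeta_coef j.
Proof.
intros HB; rewrite <- todd_coef_even.
rewrite <- (pseries_punctured_unique (fun k => B k 0 / INR (fact k)) todd_coef
              (fun t => t / (exp t - 1))).
- field; apply INR_fact_neq_0.
- apply filter_imp with (2 := HB 0); intros t.
  now rewrite Rmult_0_l, exp_0, Rmult_1_r.
- exists (mkposreal 1 Rlt_0_1); intros t Bt Nt.
  apply is_pseries_todd_coef; [exact Nt|].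
  now apply (ball_0_Rabs t (mkposreal 1 Rlt_0_1)).
Qed.

(** * Fermi-Dirac inversion *)

(** The value of the complete Fermi-Dirac integral
    [int_0^oo u^p / (1 + e^(u-L)) du] ([halfline_fermi_dirac]): after [u = v + L]
    the half-line starts at [- L], and the binomial formula gives the part on
    [[0, oo)]. *)
Definition fermi_dirac (p : nat) (L : R) : R :=
  RInt (fun v => (v + L) ^ p * fermi v) (- L) 0
  + sum_f_R0 (fun k => Binomial.C p k * L ^ (p - k) * fermi_moment k) p.

Lemma continuous_shift_pow_fermi (p : nat) (L v : R) :
  continuous (fun v => (v + L) ^ p * fermi v) v.
Proof.
apply (continuous_mult (K := R_AbsRing)); [|apply continuous_fermi].
apply continuous_of_ex_derive; intros y; auto_derive; auto.
Qed.

Lemma halfline_fermi_dirac (p : nat) (L : R) :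
  is_halfline_RInt (fun u => u ^ p * fermi (u - L)) (fermi_dirac p L).
Proof.
apply halfline_ext with
  (fun u => (1 * u + - L + L) ^ p * fermi (1 * u + - L)).
{ intros u; f_equal; f_equal; ring. }
rewrite <- (Rmult_1_l (fermi_dirac p L)), <- Rinv_1 at 1.
apply (halfline_affine 1 (- L) (fun v => (v + L) ^ p * fermi v)); [lra|].
apply halfline_ext with (fun v => sum_f_R0
  (fun k => Binomial.C p k * L ^ (p - k) * (v ^ k * fermi v)) p).
{ intros v; rewrite binomial, Rmult_comm, scal_sum; apply sum_eq; intros; ring. }
apply (halfline_sum
  (fun k v => Binomial.C p k * L ^ (p - k) * (v ^ k * fermi v))
  (fun k => Binomial.C p k * L ^ (p - k) * fermi_moment k)).
intros k _; apply halfline_scal, halfline_pow_fermi.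
Qed.

Lemma fermi_opp (v : R) : fermi v + fermi (- v) = 1.
Proof. unfold fermi; rewrite exp_Ropp; assert (P := exp_pos v); field; lra. Qed.

Lemma pow_m1_sqr (k : nat) : (-1) ^ k * (-1) ^ k = 1.
Proof.
rewrite <- Rpow_mult_distr; replace (-1 * -1) with 1 by ring; apply pow1.
Qed.

(** The inversion formula for Fermi-Dirac integrals.  Reflection turns the segment
    from [L] to [0] into the one from [- L] to [0], where
    [fermi v + fermi (- v) = 1] leaves the integral of [(v + L)^p]; in the sum of
    moments the signs [(-1)^(p+1) (-1)^(p-k) = - (-1)^k] cancel the even ones, in
    particular [ln 2]. *)
Lemma fermi_dirac_inversion (p : nat) (L : R) :
  fermi_dirac p L + (-1) ^ S p * fermi_dirac p (- L) =
  L ^ S p / INR (S p)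
  + sum_f_R0 (fun k => (1 - (-1) ^ k)
      * (Binomial.C p k * L ^ (p - k) * fermi_moment k)) p.
Proof.
assert (Ec : forall K, forall x, continuous (fun v => (v + K) ^ p * fermi v) x)
  by (intros K x; apply continuous_shift_pow_fermi).
assert (I : RInt (fun v => (v + L) ^ p * fermi v) (- L) 0
  + (-1) ^ S p * RInt (fun v => (v + - L) ^ p * fermi v) (- - L) 0
  = L ^ S p / INR (S p)).
{ pose (r := fun v => (- v + - L) ^ p * fermi (- v)).
  assert (Cr : forall x, continuous r x).
  { intros x.
    apply (continuous_comp (fun y => - y) (fun v => (v + - L) ^ p * fermi v));
      [|apply Ec].
    apply continuous_of_ex_derive; intros y; auto_derive; auto. }
  assert (Er : RInt (fun v => (v + - L) ^ p * fermi v) (- - L) 0 = - RInt r (- L) 0).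
  { rewrite <- Ropp_0 at 1.
    rewrite <- (RInt_reflect (fun v => (v + - L) ^ p * fermi v) 0 (- L)) by apply Ec.
    symmetry; apply (opp_RInt_swap (V := R_CompleteNormedModule) r).
    now apply ex_RInt_continuous_all. }
  rewrite Er.
  replace ((-1) ^ S p * - RInt r (- L) 0) with ((-1) ^ p * RInt r (- L) 0)
    by (simpl; ring).
  assert (Sm : is_RInt (fun v => (v + L) ^ p) (- L) 0
    (RInt (fun v => (v + L) ^ p * fermi v) (- L) 0 + (-1) ^ p * RInt r (- L) 0)).
  { apply is_RInt_ext with
      (fun v => plus ((v + L) ^ p * fermi v) (scal ((-1) ^ p) (r v))).
    - intros v _; unfold r.
      change ((v + L) ^ p * fermi v + (-1) ^ p * ((- v + - L) ^ p * fermi (- v))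
        = (v + L) ^ p :> R).
      replace (- v + - L) with (-1 * (v + L)) by ring.
      rewrite Rpow_mult_distr.
      transitivity ((v + L) ^ p * (fermi v + (-1) ^ p * (-1) ^ p * fermi (- v)));
        [ring|].
      rewrite pow_m1_sqr, Rmult_1_l, fermi_opp; ring.
    - apply (is_RInt_plus (V := R_NormedModule)).
      + apply (RInt_correct (V := R_CompleteNormedModule)).
        apply ex_RInt_continuous_all, Ec.
      + apply (is_RInt_scal (V := R_NormedModule)).
        apply (RInt_correct (V := R_CompleteNormedModule)).
        now apply ex_RInt_continuous_all. }
  rewrite <- (is_RInt_unique (V := R_CompleteNormedModule) _ _ _ _ Sm).
  apply (is_RInt_unique (V := R_CompleteNormedModule)).
  assert (Ni : INR (S p) <> 0) by (apply not_0_INR; lia).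
  replace (L ^ S p / INR (S p))
    with (minus ((0 + L) ^ S p / INR (S p)) ((- L + L) ^ S p / INR (S p))).
  - apply (is_RInt_derive (V := R_CompleteNormedModule)
             (fun v => (v + L) ^ S p / INR (S p))).
    + intros x _; auto_derive; [auto|].
      change (match p with 0%nat => 1 | S _ => INR p + 1 end) with (INR (S p)).
      field; exact Ni.
    + intros x _; apply continuous_of_ex_derive; intros y; auto_derive; auto.
  - unfold minus, plus, opp; simpl plus; simpl opp.
    rewrite Rplus_0_l, Rplus_opp_l, pow_i by lia.
    change (L ^ S p / INR (S p) + - (0 / INR (S p)) = L ^ S p / INR (S p)); field; exact Ni. }
unfold fermi_dirac; rewrite <- I, !Rmult_plus_distr_l, Rplus_assoc.
match goal with |- ?x + (?y + (?z + ?w)) = ?x + ?z + ?u =>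
  enough (E : y + w = u) by lra end.
rewrite scal_sum, <- sum_plus; apply sum_eq; intros k Hk.
replace (- L) with (-1 * L) by ring.
assert (Ep : (-1) ^ S p = - ((-1) ^ (p - k) * (-1) ^ k))
  by (rewrite <- pow_add, Nat.sub_add by lia; simpl; ring).
rewrite Rpow_mult_distr, Ep.
transitivity (Binomial.C p k * L ^ (p - k) * fermi_moment k
  - (-1) ^ (p - k) * (-1) ^ (p - k) * (-1) ^ k
    * (Binomial.C p k * L ^ (p - k) * fermi_moment k)); [ring|].
rewrite pow_m1_sqr; ring.
Qed.

Lemma sum_odd_terms (f : nat -> R) (p : nat) :
  sum_f_R0 (fun k => (1 - (-1) ^ k) * f k) p =
  sum_f_R0 (fun j => match j with O => 0 | S i => 2 * f (S (2 * i)) end) (S p / 2).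
Proof.
set (g := fun j => match j with O => 0 | S i => 2 * f (S (2 * i)) end).
assert (H : forall m,
  sum_f_R0 (fun k => (1 - (-1) ^ k) * f k) (2 * m) = sum_f_R0 g m
  /\ sum_f_R0 (fun k => (1 - (-1) ^ k) * f k) (S (2 * m)) = sum_f_R0 g (S m)).
{ assert (St : forall m,
    sum_f_R0 (fun k => (1 - (-1) ^ k) * f k) (2 * m) = sum_f_R0 g m ->
    sum_f_R0 (fun k => (1 - (-1) ^ k) * f k) (S (2 * m)) = sum_f_R0 g (S m)).
  { intros m E; rewrite !tech5, E, pow_1_odd; unfold g; ring. }
  induction m as [|m [IH1 IH2]].
  - split; [simpl; ring|apply St; simpl; ring].
  - assert (E : sum_f_R0 (fun k => (1 - (-1) ^ k) * f k) (2 * S m) = sum_f_R0 g (S m)).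
    { replace (2 * S m)%nat with (S (S (2 * m))) by lia.
      rewrite tech5, IH2; replace (S (S (2 * m))) with (2 * S m)%nat by lia.
      rewrite pow_1_even; ring. }
    split; [exact E|now apply St]. }
destruct (Nat.Even_or_Odd p) as [[m ->]|[m ->]].
- replace (S (2 * m) / 2)%nat with m; [apply H|].
  apply Nat.div_unique with 1%nat; lia.
- replace (2 * m + 1)%nat with (S (2 * m)) by lia.
  replace (S (S (2 * m)) / 2)%nat with (S m); [apply H|].
  apply Nat.div_unique with 0%nat; lia.
Qed.

(** With Euler's formula for [zeta (2 j)], the odd moments of index [2 j - 1]
    become the terms [j >= 1]; the term [j = 0] is [L^n]. *)
Lemma fermi_dirac_bernoulli (B : nat -> R -> R) (n : nat) (L : R) :
  bernoulli_polynomials B -> (1 <= n)%nat ->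
  fermi_dirac (n - 1) L + (-1) ^ n * fermi_dirac (n - 1) (- L) =
  1 / INR n * sum_f_R0 (fun j : nat =>
         Binomial.C n (2 * j) * (2 ^ (2 * j) - 2)
         * powerRZ (-1) (Z.of_nat j - 1) * B (2 * j)%nat 0
         * PI ^ (2 * j) * L ^ (n - 2 * j)) (n / 2).
Proof.
intros HB Hn; destruct n as [|p]; [lia|].
rewrite Nat.sub_succ, Nat.sub_0_r, fermi_dirac_inversion, sum_odd_terms.
assert (Ni : INR (S p) <> 0) by (apply not_0_INR; lia).
apply Rmult_eq_reg_l with (INR (S p)); [|exact Ni].
rewrite <- Rmult_assoc; replace (INR (S p) * (1 / INR (S p))) with 1 by (field; auto).
rewrite Rmult_1_l, Rmult_plus_distr_l.
replace (INR (S p) * (L ^ S p / INR (S p)))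
  with (sum_f_R0 (fun j => match j with O => L ^ S p | S _ => 0 end) (S p / 2)).
2: { transitivity (L ^ S p); [|field; exact Ni].
     induction (S p / 2)%nat as [|m IH]; [reflexivity|rewrite tech5, IH; ring]. }
rewrite scal_sum, <- sum_plus; apply sum_eq; intros j _.
rewrite (bernoulli_even B j HB); destruct j as [|i].
- rewrite Nat.mul_0_r, Nat.sub_0_r; unfold Binomial.C; rewrite Nat.sub_0_r.
  simpl (fact 0); simpl (Z.of_nat 0 - 1)%Z; cbn [zeta_coef pow INR powerRZ].
  change (Pos.to_nat 1) with 1%nat.
  assert (F := INR_fact_neq_0 (S p)); field; exact F.
- replace (Z.of_nat (S i) - 1)%Z with (Z.of_nat i) by lia.
  rewrite <- pow_powerRZ.
  cbn [zeta_coef fermi_moment].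
  replace (2 * S i)%nat with (S (S (2 * i))) by lia.
  rewrite Nat.sub_succ.
  unfold Binomial.C; rewrite Nat.sub_succ.
  set (m := (2 * i)%nat).
  assert (F1 := INR_fact_neq_0 (S m)); assert (F2 := INR_fact_neq_0 (p - S m)).
  change (fact (S p)) with (S p * fact p)%nat.
  change (fact (S (S m))) with (S (S m) * fact (S m))%nat.
  rewrite !mult_INR, Rpow_mult_distr.
  assert (Nm : INR (S (S m)) <> 0) by (apply not_0_INR; lia).
  assert (N2 : 2 ^ m <> 0) by (apply pow_nonzero; lra).
  assert (Np : PI ^ S (S m) <> 0) by (apply pow_nonzero, PI_neq0).
  rewrite <- !(tech_pow_Rmult 2).
  set (q := PI ^ S (S m)) in *.
  (* One sign comes from the formula, the other one from the Bernoulli number. *)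
  transitivity ((-1) ^ i * (-1) ^ i
    * (2 * (INR (fact p) / (INR (fact (S m)) * INR (fact (p - S m)))
            * L ^ (p - S m)
            * ((1 - / (2 * 2 ^ m)) * INR (fact (S m)) * zeta (S (S m))))
       * INR (S p))).
  + rewrite pow_m1_sqr; ring.
  + field; auto.
Qed.

(** * The logarithmic substitution and the evaluation *)

(** The integrand after [x = e^u], including the factor [e^u] from [dx]; the
    factor [todd] makes it continuous across [u = 0]. *)
Definition log_integrand (n : nat) (a u : R) : R :=
  u ^ (n - 2) * todd u * (exp u / (exp u + a)).

Lemma continuous_log_integrand (n : nat) (a u : R) :
  0 < a -> continuous (log_integrand n a) u.
Proof.
intros Ha; apply (continuous_mult (K := R_AbsRing)); [apply continuous_pow_mult_todd|].
apply continuous_of_ex_derive; intros y; auto_derive.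
assert (P := exp_pos y); lra.
Qed.

Lemma log_integrand_pos (n : nat) (a u : R) :
  (2 <= n)%nat -> 0 < a ->
  log_integrand n a u =
  / (1 + a) * (u ^ (n - 2) * todd u + u ^ (n - 1) * fermi (u - ln a)).
Proof.
intros Hn Ha; assert (P := exp_pos u).
replace (n - 1)%nat with (S (n - 2)) by lia; rewrite <- tech_pow_Rmult.
replace (u * u ^ (n - 2)) with (todd u * (exp u - 1) * u ^ (n - 2))
  by now rewrite todd_mult.
unfold log_integrand, fermi.
replace (exp (u - ln a)) with (exp u / a)
  by (unfold Rminus; rewrite exp_plus, exp_Ropp, exp_ln by exact Ha; reflexivity).
field; lra.
Qed.

(** The reflection [u -> - u] sends [a] to [1 / a], that is [ln a] to [- ln a]:
    [todd (- v) = todd v + v] and [fermi (- w) = 1 - fermi w], and the two extra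
    powers of [v] cancel. *)
Lemma log_integrand_neg (n : nat) (a v : R) :
  (2 <= n)%nat -> 0 < a ->
  log_integrand n a (- v) =
  / (1 + a) * ((-1) ^ n * (v ^ (n - 2) * todd v + v ^ (n - 1) * fermi (v - - ln a))).
Proof.
intros Hn Ha; rewrite log_integrand_pos, todd_opp by assumption.
assert (Em : - v = -1 * v) by ring.
replace (fermi (- v - ln a)) with (1 - fermi (v - - ln a))
  by (rewrite <- (fermi_opp (v - - ln a));
      replace (- (v - - ln a)) with (- v - ln a) by ring; ring).
replace (n - 1)%nat with (S (n - 2)) by lia.
replace n with (S (S (n - 2))) at 3 by lia.
rewrite Em, !Rpow_mult_distr, <- !tech_pow_Rmult; ring.
Qed.

Lemma integrand_log (n : nat) (a x : R) :
  (2 <= n)%nat -> 0 < a -> 0 < x -> x <> 1 ->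
  integrand n a x = / x * log_integrand n a (ln x).
Proof.
intros Hn Ha Hx H1; unfold integrand, log_integrand.
assert (Nl : ln x <> 0) by (rewrite <- ln_1; intros E; now apply H1, ln_inv; try lra).
rewrite todd_neq, exp_ln by assumption.
replace (n - 1)%nat with (S (n - 2)) by lia; rewrite <- tech_pow_Rmult.
field; lra.
Qed.

(** The substitution [u = ln x], on segments that do not have [1] in their
    interior; both sides of the singularity are of this kind. *)
Lemma is_RInt_integrand (n : nat) (a x y : R) :
  (2 <= n)%nat -> 0 < a -> 0 < x -> 0 < y ->
  (forall z, Rmin x y < z < Rmax x y -> z <> 1) ->
  is_RInt (integrand n a) x y (RInt (log_integrand n a) (ln x) (ln y)).
Proof.
intros Hn Ha Hx Hy H1.
assert (Hm : 0 < Rmin x y) by now apply Rmin_pos.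
apply is_RInt_ext with (fun z => scal (/ z) (log_integrand n a (ln z))).
- intros z Hz; symmetry; apply integrand_log; auto; lra.
- apply (is_RInt_comp (V := R_CompleteNormedModule)).
  + intros z _; now apply continuous_log_integrand.
  + intros z Hz; split.
    * auto_derive; [lra|field; lra].
    * apply (ex_derive_continuous (K := R_AbsRing) (V := R_NormedModule) Rinv z).
      auto_derive; lra.
Qed.

Lemma is_RInt_gen_integrand_above (n : nat) (a l : R) :
  (2 <= n)%nat -> 0 < a -> is_halfline_RInt (log_integrand n a) l ->
  is_RInt_gen (integrand n a) (at_point 1) (Rbar_locally p_infty) l.
Proof.
intros Hn Ha [_ Hl] P HP.
assert (Lim : filterlim (fun y => RInt (log_integrand n a) 0 (ln y))
                (Rbar_locally p_infty) (locally l))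
  by (eapply filterlim_comp; [apply is_lim_ln_p|exact Hl]).
exists (fun x => x = 1)
  (fun y => 1 < y /\ P (RInt (log_integrand n a) 0 (ln y))).
- reflexivity.
- apply filter_and; [now exists 1|exact (Lim P HP)].
- intros x y -> [Hy Py]; exists (RInt (log_integrand n a) 0 (ln y)); split; [|exact Py].
  rewrite <- ln_1; apply is_RInt_integrand; auto; try lra.
  rewrite Rmin_left, Rmax_right by lra; intros z Hz; lra.
Qed.

Lemma is_RInt_gen_integrand_below (n : nat) (a l : R) :
  (2 <= n)%nat -> 0 < a -> is_halfline_RInt (fun v => log_integrand n a (- v)) l ->
  is_RInt_gen (integrand n a) (at_right 0) (at_point 1) l.
Proof.
intros Hn Ha [_ Hl] P HP.
pose (F := fun x => RInt (fun v => log_integrand n a (- v)) 0 (- ln x)).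
assert (Lim : filterlim F (at_right 0) (locally l)).
{ apply (filterlim_comp _ _ _ (fun x => - ln x)
    (fun b => RInt (fun v => log_integrand n a (- v)) 0 b) _ (Rbar_locally p_infty));
    [|exact Hl].
  eapply filterlim_comp; [apply is_lim_ln_0|apply (filterlim_Rbar_opp m_infty)]. }
assert (E : forall x, F x = RInt (log_integrand n a) (ln x) 0).
{ intros x.
  unfold F.
  rewrite (RInt_reflect (log_integrand n a)), Ropp_0, Ropp_involutive; [reflexivity|].
  intros u; now apply continuous_log_integrand. }
exists (fun x => (0 < x /\ x < 1) /\ P (F x)) (fun y => y = 1).
- apply filter_and; [|exact (Lim P HP)].
  exists (mkposreal 1 Rlt_0_1); intros x Bx Hx; split; [exact Hx|].
  apply (proj1 (ball_0_Rabs x _)) in Bx; rewrite Rabs_pos_eq in Bx by lra; exact Bx.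
- reflexivity.
- intros x y [[Hx0 Hx1] Px] ->; exists (F x); split; [|exact Px].
  rewrite E, <- ln_1 at 1; apply is_RInt_integrand; auto; try lra.
  rewrite Rmin_left, Rmax_right by lra; intros z Hz; lra.
Qed.

Theorem theorem2p4 (B : nat -> R -> R) (hB : bernoulli_polynomials B)
    (n : nat) (hn : (2 <= n)%nat) (a : R) (ha : 0 < a) :
  is_RInt_gen (integrand n a) (at_right 0) (Rbar_locally p_infty)
    ((-1) ^ n * INR (fact (n - 1)) / (1 + a) * (1 + (-1) ^ n) * zeta n
     + 1 / (INR n * (1 + a)) *
       sum_f_R0 (fun j : nat =>
         Binomial.C n (2 * j) * (2 ^ (2 * j) - 2)
         * powerRZ (-1) (Z.of_nat j - 1) * B (2 * j)%nat 0
         * PI ^ (2 * j) * (ln a) ^ (n - 2 * j)) (n / 2)).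
Proof.
assert (Pt := halfline_pow_todd (n - 2)).
replace (S (S (n - 2))) with n in Pt by lia.
replace (S (n - 2)) with (n - 1)%nat in Pt by lia.
assert (Lp := halfline_scal (/ (1 + a)) _ _
  (halfline_plus _ _ _ _ Pt (halfline_fermi_dirac (n - 1) (ln a)))).
assert (Lm := halfline_scal (/ (1 + a)) _ _ (halfline_scal ((-1) ^ n) _ _
  (halfline_plus _ _ _ _ Pt (halfline_fermi_dirac (n - 1) (- ln a))))).
apply (halfline_ext _ (log_integrand n a)) in Lp;
  [|intros u; symmetry; now apply log_integrand_pos].
apply (halfline_ext _ (fun v => log_integrand n a (- v))) in Lm;
  [|intros v; symmetry; now apply log_integrand_neg].
assert (G := is_RInt_gen_Chasles _ _ _ _
  (is_RInt_gen_integrand_below n a _ hn ha Lm)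
  (is_RInt_gen_integrand_above n a _ hn ha Lp)).
match type of G with is_RInt_gen _ _ _ ?l => match goal with
  |- is_RInt_gen _ _ _ ?r => replace r with l; [exact G|] end end.
match goal with |- _ = ?r => change (
  / (1 + a) * ((-1) ^ n * (INR (fact (n - 1)) * zeta n + fermi_dirac (n - 1) (- ln a)))
  + / (1 + a) * (INR (fact (n - 1)) * zeta n + fermi_dirac (n - 1) (ln a)) = r :> R) end.
assert (Nn : INR n <> 0) by (apply not_0_INR; lia).
assert (Fb := fermi_dirac_bernoulli B n (ln a) hB ltac:(lia)).
set (sm := sum_f_R0 _ _) in *.
replace (1 / (INR n * (1 + a)) * sm) with (/ (1 + a) * (1 / INR n * sm)) by (field; lra).
rewrite <- Fb.
transitivity (/ (1 + a) * (fermi_dirac (n - 1) (ln a)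
  + (-1) ^ n * fermi_dirac (n - 1) (- ln a)
  + ((-1) ^ n * (-1) ^ n + (-1) ^ n) * INR (fact (n - 1)) * zeta n)).
- rewrite pow_m1_sqr; ring.
- field; lra.
Qed.
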